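(* Let $g\in\mathbb C\setminus\{0\}$ and $m\in\mathbb C$. Identify $F(g)$ with $W_L$ via $b\mapsto e^\beta$. The map $\chi_m:\mathrm M(m)\to W_L(m\beta^\circ)$, i.e. the surjective homomorphism of $F(g)$-modules determined by $\chi_m(v_m)=e^{m\beta^\circ}$, is an isomorphism.
   Context: All vector spaces are over $\mathbb C$. For a vector space $U$, $U\{z\}$ is the space of formal sums $\sum_{n\in\mathbb C}a_nz^n$ with $a_n\in U$, and $U[[z]]z^{c+\mathbb Z}=\{\sum_{n\ge N}a_nz^{n+c}: N\in\mathbb Z,\ a_n\in U\}$. Powers $(x-y)^n$ are expanded in non-negative integer powers of $y$. Generalized vertex algebras (GVAs). Let $A$ be an abelian group with a bimultiplicative map $\eta:A\times A\to\mathbb C^\times$ (the phase), and let $\Delta:A\times A\to\mathbb C/\mathbb Z$ be the biadditive map with $\eta_{\gamma,\delta}\eta_{\delta,\gamma}=e^{-2\pi\sqrt{-1}\Delta(\gamma,\delta)}$. An $A$-graded GVA is an $A$-graded space $V=\bigoplus_{\gamma\in A} V^\gamma$ with a linear map $Y(\cdot,z):V\to\mathrm{End}(V)\{z\}$, $Y(u,z)=\sum_{n\in\mathbb C}u(n)z^{-n-1}$, a vector $\mathbf 1\in V^0$ and a grading-preserving operator $\partial$ such that for $u\in V^\gamma$, $v\in V^\delta$: $Y(\mathbf 1,z)=\mathrm{id}$, $Y(u,z)\mathbf 1\in u+zV[[z]]$, $\partial\mathbf 1=0$; $[\partial,Y(u,z)]=\partial_zY(u,z)$; $Y(u,z)v\in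 V^{\gamma+\delta}[[z]]z^{-\Delta(\gamma,\delta)}$; and there is $N\in\Delta(\gamma,\delta)$ with $(z-w)^NY(u,z)Y(v,w)=\eta_{\gamma,\delta}e^{\pi\sqrt{-1}N}(w-z)^NY(v,w)Y(u,z)$. Modules. Let $B$ be a set with a free (additively written) $A$-action and $\Delta_1:A\times B\to\mathbb C/\mathbb Z$ a biadditive map extending $\Delta$. A $B$-graded $V$-module is a space $M=\bigoplus_{\lambda\in B}M^\lambda$ with a linear map $Y:V\to\mathrm{End}(M)\{z\}$ such that for $u\in V^\gamma,v\in V^\delta,x\in M^\lambda$: $Y(\mathbf 1,z)=\mathrm{id}_M$; $Y(u,z)x\in M^{\gamma+\lambda}[[z]]z^{-\Delta_1(\gamma,\lambda)}$; and for all $n\in\Delta(\gamma,\delta)$, $(z-w)^nY(u,z)Y(v,w)x-\eta_{\gamma,\delta}e^{\pi\sqrt{-1}n}(w-z)^nY(v,w)Y(u,z)x=\sum_{j\ge0}\frac1{j!}\partial_w^j\delta(z,w)\,Y(u(n+j)v,w)x$ with $\delta(z,w)=\sum_{j\in\Delta_1(\gamma,\lambda)}z^{-j-1}w^j$. Free GVA and free modules. $\mathcal G(g)$ is the category of $\mathbb Z$-graded GVAs with phase $\eta_{r,s}=e^{\pi\sqrt{-1}grs}$ generated by a degree $1$ element $b$ with $(z-w)^{-g}Y(b,z)Y(b,w)=(w-z)^{-g}Y(b,w)Y(b,z)$; $F(g)$ is its initial object. $\mathrm M(m)$ is the universal $\mathbb Z$-graded $F(g)$-module (with $\Delta_1(r,s)=-mr-grs+\mathbb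 Z$) generated by a degree $0$ vector $v_m$ with $b(-m+n)v_m=0$ for all $n\in\mathbb C\setminus\mathbb Z_{<0}$. Lattice realization. Let $\mathfrak h$ be a one-dimensional space with a non-degenerate symmetric bilinear form $(\cdot,\cdot)$, with Heisenberg algebra spanned by $h(n)$ ($h\in\mathfrak h,n\in\mathbb Z$) and central $K=1$, $[h(n),h'(k)]=n(h,h')\delta_{n+k,0}$. For $\gamma\in\mathfrak h$ let $M(1,\gamma)$ be the Fock module generated by $e^\gamma$ with $h(n)e^\gamma=0$ ($n>0$), $h(0)e^\gamma=(h,\gamma)e^\gamma$. $V_{\mathfrak h}=\bigoplus_{\gamma\in\mathfrak h}M(1,\gamma)$ is a GVA graded by $\mathfrak h$ with phase $e^{\pi\sqrt{-1}(\gamma,\delta)}$, vacuum $e^0$ and $$Y(e^\gamma,z)=\sum_{n\in\mathbb C}e^\gamma(n)z^{-n-1}=\exp\Bigl(\sum_{n<0}\tfrac{\gamma(n)}{-n}z^{-n}\Bigr)\exp\Bigl(\sum_{n>0}\tfrac{\gamma(n)}{-n}z^{-n}\Bigr)e_\gamma z^{\gamma(0)},$$ where $z^{\gamma(0)}$ acts on $M(1,\delta)$ by $z^{(\gamma,\delta)}$ and $e_\gamma$ maps $M(1,\delta)$ to $M(1,\gamma+\delta)$, commuting with $h(n)$ for $n\ne0$ and sending $e^\delta$ to $e^{\gamma+\delta}$. Let $\beta\in\mathfrak h$ with $(\beta,\beta)=g$, $\beta^\circ=\beta/g$, $L=\mathbb Z\beta$. $W_L\subset V_{\mathfrak h}$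 is the sub-GVA generated by $e^\beta$ (graded by $L\simeq\mathbb Z$, $r\beta\leftrightarrow r$); it is an object of $\mathcal G(g)$ with $b=e^\beta$, and the canonical morphism $F(g)\to W_L$ is an isomorphism. $W_L(m\beta^\circ)=W_L\cdot e^{m\beta^\circ}\subset V_{\mathfrak h}$ is the cyclic $W_L$-module generated by $e^{m\beta^\circ}$, graded by $m\beta^\circ+r\beta\leftrightarrow r$. One has $e^\beta(-m+n)e^{m\beta^\circ}=0$ for $n\in\mathbb C\setminus\mathbb Z_{<0}$, so the universal property of $\mathrm M(m)$ gives the surjection $\chi_m$. *)

(* Defs.v *)
(* The complex numbers are R[i] for R : realType. *)
Set Warnings "-notation-overridden,-ambiguous-paths,-notation-incompatible-prefix,-notation-incompatible-format,-redundant-canonical-projection,-projection-no-head-constant".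
From HB Require Import structures.
From mathcomp Require Import all_boot all_order all_algebra.
From mathcomp.finmap Require Import finmap multiset.
From mathcomp Require Import all_classical all_reals all_analysis.
From mathcomp Require Import complex.
(* The notations of monalg clash with those of MathComp-Analysis. *)
From mathcomp Require monalg.
Import -(notations) monalg.

Set Implicit Arguments.
Unset Strict Implicit.
Unset Printing Implicit Defensive.

Import Order.TTheory GRing.Theory Num.Theory.

Local Open Scope classical_set_scope.
Local Open Scope ring_scope.
Local Open Scope complex_scope.
Local Open Scope quotient_scope.

Definition cexp (R : realType) (z : R[i]) : R[i] :=
  (expR (complex.Re z))%:C * (cos (complex.Im z) +i* sin (complex.Im z)).

(* e^{pi sqrt(-1) z} *)
Definition expipi (R : realType) (z : R[i]) : R[i] :=
  cexp (Complex 0 pi * z).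

Definition cbinom (R : realType) (z : R[i]) (k : nat) : R[i] :=
  (\prod_(i < k) (z - i%:R)) / k`!%:R.

Definition cint_pred (R : realType) : {pred R[i]} :=
  [pred x | `[< exists k : int, x = k%:~R >]].

Lemma cint_closed (R : realType) : zmod_closed (@cint_pred R).
Proof.
split=> [|x y]; first by apply: asboolT; exists 0.
move=> /asboolW[k ->] /asboolW[l ->]; apply: asboolT.
by exists (k - l); rewrite rmorphB.
Qed.

HB.instance Definition _ (R : realType) :=
  GRing.isZmodClosed.Build R[i] (@cint_pred R) (@cint_closed R).

Definition CmodZ (R : realType) : zmodType := Quotient.quot (@cint_pred R).

Definition classZ (R : realType) (x : R[i]) : CmodZ R :=
  \pi_(Quotient.quot (@cint_pred R)) x.

Definition is_linear (K : pzRingType) (U V : lmodType K) (f : U -> V) : Prop :=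
  forall a u v, f (a *: u + v) = a *: f u + f v.

Definition subspace (K : pzRingType) (V : lmodType K) (P : set V) : Prop :=
  P 0 /\ forall a u v, P u -> P v -> P (a *: u + v).

Section SubspaceLmod.
Variables (K : pzRingType) (V : lmodType K) (P : set V) (hP : subspace P).

Definition subspace_pred of subspace P : {pred V} := [pred v | `[< P v >]].

Lemma subspace_pred_closed : submod_closed (subspace_pred hP).
Proof.
split=> [|a u v]; first by apply: asboolT; exact: hP.1.
by move=> /asboolW hu /asboolW hv; apply: asboolT; apply: hP.2.
Qed.

HB.instance Definition _ :=
  GRing.isSubmodClosed.Build K V (subspace_pred hP) subspace_pred_closed.

Record subspace_type :=
  SubspaceType { subspace_val : V; _ : subspace_val \in subspace_pred hP }.

HB.instance Definition _ := [isSub for subspace_val].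
HB.instance Definition _ := [Choice of subspace_type by <:].
HB.instance Definition _ := [SubChoice_isSubLmodule of subspace_type by <:].

Lemma in_subspace (v : V) : P v -> v \in subspace_pred hP.
Proof. by move=> hv; apply: asboolT. Qed.

Lemma subspace_valP (x : subspace_type) : P (subspace_val x).
Proof. by case: x => v /= /asboolW. Qed.

Definition to_subspace (v : V) (hv : P v) : subspace_type :=
  SubspaceType (in_subspace hv).

End SubspaceLmod.

(* V is the (internal) direct sum of the subspaces V_i, i : I. *)
Definition is_grading (K : pzRingType) (V : lmodType K) (I : choiceType)
    (deg : I -> set V) : Prop :=
  [/\ forall i, subspace (deg i),
      forall v, exists (s : seq I) (f : I -> V),
        (forall i, deg i (f i)) /\ v = \sum_(i <- s) f i
    & forall (s : seq I) (f : I -> V), uniq s -> (forall i, deg i (f i)) ->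
        \sum_(i <- s) f i = 0 -> {in s, forall i, f i = 0}].

(* A series in U{z} is given by its modes a(n), n : R[i], and stands for
  sum_n a(n) z^{-n-1}; a series in U{z,w} is given by its modes a(p,q) and
  stands for sum_{p,q} a(p,q) z^{-p-1} w^{-q-1}.  Sums of the form
  \sum_(i \in A) are sums of finitely supported families.  *)

(* sum_n a(n) z^{-n-1} lies in P[[z]] z^{-D}, for D a class in C/Z. *)
Definition series_in (R : realType) (U : lmodType R[i]) (P : set U)
    (D : CmodZ R) (a : R[i] -> U) : Prop :=
  [/\ forall n, P (a n), forall n, classZ n <> D -> a n = 0
    & exists n0, classZ n0 = D /\ forall k : nat, a (n0 + k%:R) = 0].

(* Multiplication by (z - w)^n = sum_i binom(n, i) (-1)^i z^{n-i} w^i. *)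
Definition mul_zw (R : realType) (U : lmodType R[i]) (n : R[i])
    (a : R[i] -> R[i] -> U) (p q : R[i]) : U :=
  \sum_(i \in [set: nat])
    ((-1) ^+ i * cbinom n i) *: a (p + n - i%:R) (q + i%:R).

(* Multiplication by (w - z)^n = sum_i binom(n, i) (-1)^i w^{n-i} z^i. *)
Definition mul_wz (R : realType) (U : lmodType R[i]) (n : R[i])
    (a : R[i] -> R[i] -> U) (p q : R[i]) : U :=
  \sum_(i \in [set: nat])
    ((-1) ^+ i * cbinom n i) *: a (p + i%:R) (q + n - i%:R).

(* sum_{j >= 0} 1/j! d_w^j delta(z,w) a_j(w), where
   delta(z,w) = sum_{k in D} z^{-k-1} w^k: the coefficient of z^{-p-1} in
   1/j! d_w^j delta(z,w) is binom(p, j) w^{p-j} if p is in D, and 0 if not. *)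
Definition delta_sum (R : realType) (U : lmodType R[i]) (D : CmodZ R)
    (a : nat -> R[i] -> U) (p q : R[i]) : U :=
  if classZ p == D then
    \sum_(j \in [set: nat]) cbinom p j *: a j (p + q - j%:R)
  else 0.

Record is_phase (R : realType) (A : zmodType) (eta : A -> A -> R[i])
    (Delta : A -> A -> CmodZ R) : Prop := IsPhase {
  phase_neq0 : forall r s, eta r s != 0;
  phaseMl : forall r r' s, eta (r + r') s = eta r s * eta r' s;
  phaseMr : forall r s s', eta r (s + s') = eta r s * eta r s';
  phase_DeltaDl : forall r r' s, Delta (r + r') s = Delta r s + Delta r' s;
  phase_DeltaDr : forall r s s', Delta r (s + s') = Delta r s + Delta r s';
  phase_Delta : forall r s n, classZ n = Delta r s ->
    eta r s * eta s r = expipi (- 2 * n) }.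

(* [gva_mode u n v] is u(n)v; the axioms are in [is_gva]. *)
Record gva (R : realType) (A : zmodType) := Gva {
  gva_car :> lmodType R[i];
  gva_deg : A -> set gva_car;
  gva_mode : gva_car -> R[i] -> gva_car -> gva_car;
  gva_vac : gva_car;
  gva_der : gva_car -> gva_car }.

Arguments gva_deg {R A} _ _ _.
Arguments gva_mode {R A} _ _ _ _.
Arguments gva_vac {R A} _.
Arguments gva_der {R A} _ _.

Record is_gva (R : realType) (A : zmodType) (eta : A -> A -> R[i])
    (Delta : A -> A -> CmodZ R) (V : gva R A) : Prop := IsGva {
  gva_phase : is_phase eta Delta;
  gva_grading : is_grading (gva_deg V);
  gva_mode_linl : forall n v, is_linear (fun u => gva_mode V u n v);
  gva_mode_linr : forall u n, is_linear (gva_mode V u n);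
  gva_der_lin : is_linear (gva_der V);
  gva_vac_deg : gva_deg V 0 (gva_vac V);
  gva_der_deg : forall r u, gva_deg V r u -> gva_deg V r (gva_der V u);
  gva_vac_id : forall n v,
    gva_mode V (gva_vac V) n v = if n == -1 then v else 0;
  gva_creation : forall u, gva_mode V u (-1) (gva_vac V) = u /\
    forall n, ~ (exists k : nat, n = - k.+1%:R) ->
      gva_mode V u n (gva_vac V) = 0;
  gva_der_vac : gva_der V (gva_vac V) = 0;
  (* [d, Y(u,z)] = d_z Y(u,z) *)
  gva_der_mode : forall u n v,
    gva_der V (gva_mode V u n v) - gva_mode V u n (gva_der V v) =
    - n *: gva_mode V u (n - 1) v;
  gva_series : forall r s u v, gva_deg V r u -> gva_deg V s v ->
    series_in (gva_deg V (r + s)) (Delta r s) (fun n => gva_mode V u n v);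
  gva_locality : forall r s u v, gva_deg V r u -> gva_deg V s v ->
    exists2 N, classZ N = Delta r s & forall x p q,
      mul_zw N (fun p' q' => gva_mode V u p' (gva_mode V v q' x)) p q =
      (eta r s * expipi N) *:
      mul_wz N (fun p' q' => gva_mode V v q' (gva_mode V u p' x)) p q }.

Record gva_hom (R : realType) (A : zmodType) (V W : gva R A) (f : V -> W)
    : Prop := GvaHom {
  gva_hom_lin : is_linear f;
  gva_hom_deg : forall r u, gva_deg V r u -> gva_deg W r (f u);
  gva_hom_vac : f (gva_vac V) = gva_vac W;
  gva_hom_der : forall u, f (gva_der V u) = gva_der W (f u);
  gva_hom_mode : forall u n v,
    f (gva_mode V u n v) = gva_mode W (f u) n (f v) }.

Record subgva (R : realType) (A : zmodType) (V : gva R A) (S : set V)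
    : Prop := Subgva {
  subgva_subspace : subspace S;
  subgva_vac : S (gva_vac V);
  subgva_der : forall u, S u -> S (gva_der V u);
  subgva_mode : forall u n v, S u -> S v -> S (gva_mode V u n v) }.

Definition gen_subgva (R : realType) (A : zmodType) (V : gva R A) (b : V)
    : set V :=
  [set x | forall S : set V, subgva S -> S b -> S x].

Lemma gen_subgvaP (R : realType) (A : zmodType) (V : gva R A) (b : V) :
  subgva (gen_subgva b).
Proof.
split=> [|S hS _|u hu S hS Sb|u n v hu hv S hS Sb].
- split=> [S hS _|a u v hu hv S hS Sb]; first exact: (subgva_subspace hS).1.
  by apply: (subgva_subspace hS).2; [apply: hu | apply: hv].
- exact: subgva_vac.
- by apply: subgva_der => //; apply: hu.
- by apply: subgva_mode => //; [apply: hu | apply: hv].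
Qed.

Lemma gen_subgva_gen (R : realType) (A : zmodType) (V : gva R A) (b : V) :
  gen_subgva b b.
Proof. by []. Qed.

(* A sub-GVA S of V, graded by A' along iota : A' -> A. *)
Definition sub_gva (R : realType) (A A' : zmodType) (iota : A' -> A)
    (V : gva R A) (S : set V) (hS : subgva S) : gva R A' :=
  @Gva R A' (subspace_type (subgva_subspace hS))
    (fun r => [set u | gva_deg V (iota r) (subspace_val u)])
    (fun u n v => to_subspace (subgva_subspace hS)
       (subgva_mode hS n (subspace_valP u) (subspace_valP v)))
    (to_subspace (subgva_subspace hS) (subgva_vac hS))
    (fun u => to_subspace (subgva_subspace hS)
       (subgva_der hS (subspace_valP u))).

(* [gmod_mode u n x] is u(n)x; the axioms are in [is_gmod]. *)
Record gmod (R : realType) (V : lmodType R[i]) (B : choiceType) := Gmod {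
  gmod_car :> lmodType R[i];
  gmod_deg : B -> set gmod_car;
  gmod_mode : V -> R[i] -> gmod_car -> gmod_car }.

Arguments gmod_deg {R V B} _ _ _.
Arguments gmod_mode {R V B} _ _ _ _.

Record is_gmod (R : realType) (A : zmodType) (eta : A -> A -> R[i])
    (Delta : A -> A -> CmodZ R) (V : gva R A) (B : choiceType)
    (act : A -> B -> B) (Delta1 : A -> B -> CmodZ R) (M : gmod V B)
    : Prop := IsGmod {
  gmod_act0 : forall l, act 0 l = l;
  gmod_actD : forall r s l, act (r + s) l = act r (act s l);
  gmod_act_free : forall r l, act r l = l -> r = 0;
  gmod_Delta1Dl : forall r s l, Delta1 (r + s) l = Delta1 r l + Delta1 s l;
  gmod_Delta1Dr : forall r s l, Delta1 r (act s l) = Delta r s + Delta1 r l;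
  gmod_grading : is_grading (gmod_deg M);
  gmod_mode_linl : forall n x, is_linear (fun u : V => gmod_mode M u n x);
  gmod_mode_linr : forall u n, is_linear (gmod_mode M u n);
  gmod_vac_id : forall n x,
    gmod_mode M (gva_vac V) n x = if n == -1 then x else 0;
  gmod_series : forall r l u x, gva_deg V r u -> gmod_deg M l x ->
    series_in (gmod_deg M (act r l)) (Delta1 r l)
      (fun n => gmod_mode M u n x);
  gmod_borcherds : forall r s l u v x,
    gva_deg V r u -> gva_deg V s v -> gmod_deg M l x ->
    forall n, classZ n = Delta r s -> forall p q,
      mul_zw n (fun p' q' => gmod_mode M u p' (gmod_mode M v q' x)) p q -
      (eta r s * expipi n) *:
      mul_wz n (fun p' q' => gmod_mode M v q' (gmod_mode M u p' x)) p q =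
      delta_sum (Delta1 r l)
        (fun j q' => gmod_mode M (gva_mode V u (n + j%:R) v) q' x) p q }.

Record gmod_hom (R : realType) (V : lmodType R[i]) (B : choiceType)
    (M N : gmod V B) (f : M -> N) : Prop := GmodHom {
  gmod_hom_lin : is_linear f;
  gmod_hom_deg : forall l x, gmod_deg M l x -> gmod_deg N l (f x);
  gmod_hom_mode : forall (u : V) n x,
    f (gmod_mode M u n x) = gmod_mode N u n (f x) }.

Definition gmod_iso (R : realType) (V : lmodType R[i]) (B : choiceType)
    (M N : gmod V B) (f : M -> N) : Prop :=
  gmod_hom f /\
  exists f' : N -> M, [/\ gmod_hom f', cancel f f' & cancel f' f].

Record submod (R : realType) (V : lmodType R[i]) (B : choiceType)
    (M : gmod V B) (S : set M) : Prop := Submod {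
  submod_subspace : subspace S;
  submod_mode : forall (u : V) n x, S x -> S (gmod_mode M u n x) }.

Definition gen_submod (R : realType) (V : lmodType R[i]) (B : choiceType)
    (M : gmod V B) (v : M) : set M :=
  [set x | forall S : set M, submod S -> S v -> S x].

Lemma gen_submodP (R : realType) (V : lmodType R[i]) (B : choiceType)
  (M : gmod V B) (v : M) : submod (gen_submod v).
Proof.
split=> [|u n x hx S hS Sv]; last by apply: submod_mode => //; apply: hx.
split=> [S hS _|a x y hx hy S hS Sv]; first exact: (submod_subspace hS).1.
by apply: (submod_subspace hS).2; [apply: hx | apply: hy].
Qed.

Lemma gen_submod_gen (R : realType) (V : lmodType R[i]) (B : choiceType)
  (M : gmod V B) (v : M) : gen_submod v v.
Proof. by []. Qed.

(* A submodule S of M, graded by B' along iota : B' -> B. *)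
Definition sub_gmod (R : realType) (V : lmodType R[i]) (B B' : choiceType)
    (iota : B' -> B) (M : gmod V B) (S : set M) (hS : submod S) : gmod V B' :=
  @Gmod R V B' (subspace_type (submod_subspace hS))
    (fun l => [set x | gmod_deg M (iota l) (subspace_val x)])
    (fun u n x => to_subspace (submod_subspace hS)
       (submod_mode hS u n (subspace_valP x))).

(* Restriction of scalars along f : U -> V. *)
Definition pull_gmod (R : realType) (U V : lmodType R[i]) (f : U -> V)
    (B : choiceType) (M : gmod V B) : gmod U B :=
  @Gmod R U B M (gmod_deg M) (fun u => gmod_mode M (f u)).

Definition free_phase (R : realType) (g : R[i]) (r s : int) : R[i] :=
  expipi (g * r%:~R * s%:~R).

Definition free_Delta (R : realType) (g : R[i]) (r s : int) : CmodZ R :=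
  classZ (- (g * r%:~R * s%:~R)).

(* Objects (V, b) of the category G(g). *)
Record in_G (R : realType) (g : R[i]) (V : gva R int) (b : V) : Prop := InG {
  in_G_gva : is_gva (free_phase g) (free_Delta g) V;
  in_G_deg : gva_deg V 1 b;
  in_G_gen : gen_subgva b = setT;
  in_G_locality : forall x p q,
    mul_zw (- g) (fun p' q' => gva_mode V b p' (gva_mode V b q' x)) p q =
    mul_wz (- g) (fun p' q' => gva_mode V b q' (gva_mode V b p' x)) p q }.

(* (F, b) is an initial object of G(g), that is, F = F(g). *)
Definition is_free_gva (R : realType) (g : R[i]) (F : gva R int) (b : F)
    : Prop :=
  in_G g b /\
  forall (V : gva R int) (b' : V), in_G g b' ->
    exists f : F -> V, [/\ gva_hom f, f b = b'
      & forall f' : F -> V, gva_hom f' -> f' b = b' -> f' =1 f].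

Definition free_Delta1 (R : realType) (g m : R[i]) (r s : int) : CmodZ R :=
  classZ (- (m * r%:~R) - g * r%:~R * s%:~R).

(* Pairs (M, v) of a Z-graded F-module and a degree 0 vector generating it, with
   b(-m+n)v = 0 for all n outside Z_{<0}. *)
Record in_Mod (R : realType) (g m : R[i]) (F : gva R int) (b : F)
    (M : gmod F int) (v : M) : Prop := InMod {
  in_Mod_gmod : is_gmod (free_phase g) (free_Delta g)
    (fun r s : int => r + s) (free_Delta1 g m) M;
  in_Mod_deg : gmod_deg M 0 v;
  in_Mod_gen : gen_submod v = setT;
  in_Mod_ann : forall n, ~ (exists k : nat, n = - k.+1%:R) ->
    gmod_mode M b (- m + n) v = 0 }.

(* (M, v) is universal among these pairs, that is, M = M(m) and v = v_m. *)
Definition is_free_mod (R : realType) (g m : R[i]) (F : gva R int) (b : F)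
    (M : gmod F int) (v : M) : Prop :=
  in_Mod g m b v /\
  forall (N : gmod F int) (w : N), in_Mod g m b w ->
    exists f : M -> N, [/\ gmod_hom f, f v = w
      & forall f' : M -> N, gmod_hom f' -> f' v = w -> f' =1 f].

Record is_form (R : realType) (h : lmodType R[i]) (form : h -> h -> R[i])
    : Prop := IsForm {
  form_linl : forall a x y z, form (a *: x + y) z = a * form x z + form y z;
  form_sym : forall x y, form x y = form y x;
  form_nondeg : forall x, (forall y, form x y = 0) -> x = 0 }.

Section Lattice.
Variables (R : realType) (h : vectType R[i]) (form : h -> h -> R[i]).
(* A vector spanning the line h, with (beta, beta) <> 0. *)
Variable beta : h.

(* The basis vector indexed by (gamma, {k_1, ..., k_r}) is
   beta(-k_1-1) ... beta(-k_r-1) e^gamma. *)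
Definition fock_index : choiceType := (h * {mset nat}%mset)%type.

Definition fock : lmodType R[i] := malg fock_index R[i].

Definition fock_basis (x : fock_index) : fock := mkmalgU x 1.

Definition fock_ext (f : fock_index -> fock) (v : fock) : fock :=
  \sum_(x <- msupp v) mcoeff x v *: f x.

(* M(1, gamma) *)
Definition fock_deg (gamma : h) : set fock :=
  [set v | forall x, x \in (msupp v : seq fock_index) -> x.1 = gamma].

Definition fock_exp (gamma : h) : fock := fock_basis (gamma, mset0).

(* a(n).  As h is a line, a = (a,beta)/(beta,beta) beta;
   beta(-k-1) acts by multiplication and beta(k+1) by (k+1)(beta,beta) times the
   derivation with respect to beta(-k-1). *)
Definition heis (a : h) (n : int) : fock -> fock :=
  fock_ext (fun x : fock_index => match n with
    | Posz 0 => form a x.1 *: fock_basis x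
    | Posz k.+1 =>
        (k.+1%:R * form a beta * (x.2 k)%:R) *: fock_basis (x.1, (x.2 `\ k)%mset)
    | Negz k =>
        (form a beta / form beta beta) *: fock_basis (x.1, (k +` x.2)%mset)
    end).

(* e_gamma *)
Definition fock_shift (gamma : h) : fock -> fock :=
  fock_ext (fun x => fock_basis (gamma + x.1, x.2)).

(* The coefficient of t^j in (sum_{k >= 0} T_k t^{k+1})^r. *)
Fixpoint pow_coef (T : nat -> fock -> fock) (r j : nat) (v : fock) : fock :=
  match r with
  | 0 => if j == 0%N then v else 0
  | r'.+1 => \sum_(k < j) T k (pow_coef T r' (j - k.+1)%N v)
  end.

(* The coefficient of t^j in exp(sum_{k >= 0} T_k t^{k+1}). *)
Definition exp_coef (T : nat -> fock -> fock) (j : nat) (v : fock) : fock :=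
  \sum_(r < j.+1) r`!%:R^-1 *: pow_coef T r j v.

(* e^gamma(n): the contributions are those of z^p in the first exponential, of
   z^{-q} in the second one, and of z^{(gamma, delta)} on M(1, delta). *)
Definition vertex_exp (gamma : h) (n : R[i]) : fock -> fock :=
  fock_ext (fun x : fock_index =>
    \sum_(pq \in [set pq : nat * nat |
                   pq.1%:R - pq.2%:R + form gamma x.1 = - n - 1])
      exp_coef (fun k v => k.+1%:R^-1 *: heis gamma (- k.+1%:Z) v) pq.1
        (exp_coef (fun k v => - k.+1%:R^-1 *: heis gamma k.+1%:Z v) pq.2
          (fock_shift gamma (fock_basis x)))).

(* Modes of the field of beta(-k_1-1) ... beta(-k_r-1) e^gamma, which is the
   normally ordered product
     Y(beta(-k-1)u, z) = a^-(z) Y(u, z) + Y(u, z) a^+(z),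
   where a(z) = 1/k! d_z^k sum_p beta(p) z^{-p-1}
              = sum_p binom(-p-1, k) beta(p) z^{-p-1-k}
   and a^-, a^+ are its parts with p < 0 and p >= 0. *)
Fixpoint vertex_nord (s : seq nat) (gamma : h) (n : R[i]) (v : fock) : fock :=
  match s with
  | [::] => vertex_exp gamma n v
  | k :: s' =>
      \sum_(j \in [set: nat]) cbinom j%:R k *:
        heis beta (- j.+1%:Z) (vertex_nord s' gamma (n + j%:R - k%:R) v) +
      \sum_(j \in [set: nat]) cbinom (- j%:R - 1) k *:
        vertex_nord s' gamma (n - j%:R - 1 - k%:R) (heis beta j%:Z v)
  end.

Definition lattice_mode (u : fock) (n : R[i]) (v : fock) : fock :=
  fock_ext (fun x : fock_index => vertex_nord (enum_mset x.2) x.1 n v) u.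

(* V_h; in any GVA, the derivation is u |-> u(-2)1. *)
Definition lattice_gva : gva R h :=
  @Gva R h fock fock_deg lattice_mode (fock_exp 0)
    (fun u => lattice_mode u (- 2) (fock_exp 0)).

(* W_L, graded by r beta <-> r. *)
Definition W_L : gva R int :=
  sub_gva (fun r : int => beta *~ r)
    (@gen_subgvaP R h lattice_gva (fock_exp beta)).

Definition W_L_gen : W_L :=
  to_subspace (subgva_subspace (@gen_subgvaP R h lattice_gva (fock_exp beta)))
    (@gen_subgva_gen R h lattice_gva (fock_exp beta)).

(* V_h as a module over W_L. *)
Definition lattice_gmod : gmod W_L h :=
  @Gmod R W_L h fock fock_deg (fun u => lattice_mode (subspace_val u)).

(* beta / (beta, beta) *)
Definition beta_dual : h := (form beta beta)^-1 *: beta.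

(* W_L(m beta_dual), graded by m beta_dual + r beta <-> r. *)
Definition W_L_mod (m : R[i]) : gmod W_L int :=
  sub_gmod (fun r : int => m *: beta_dual + beta *~ r)
    (@gen_submodP R W_L h lattice_gmod (fock_exp (m *: beta_dual))).

Definition W_L_mod_gen (m : R[i]) : W_L_mod m :=
  to_subspace
    (submod_subspace (@gen_submodP R W_L h lattice_gmod (fock_exp (m *: beta_dual))))
    (@gen_submod_gen R W_L h lattice_gmod (fock_exp (m *: beta_dual))).

End Lattice.

(* Main.v *)
Require Import Defs.
From mathcomp Require Import all_boot all_order all_algebra.
From mathcomp Require Import all_classical all_reals.
From mathcomp Require Import exp trigo.
From mathcomp Require Import complex ring zify.
From mathcomp.finmap Require Import finmap multiset.
From mathcomp Require monalg.
Import -(notations) monalg.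

Set Implicit Arguments.
Unset Strict Implicit.
Unset Printing Implicit Defensive.

Import Order.TTheory GRing.Theory Num.Theory.

Local Open Scope ring_scope.

(** The homomorphism chi is onto, because its image is a submodule containing
    the generator.  For injectivity one finds a spanning family of M = M(m)
    whose image under chi is linearly independent.

    The spanning family.  On vectors of degree r, Y(b, z) is z^(m + g r) times
    a series B(z) in integral powers of z.  Since b(- g + j) b = 0 for j >= 0
    ([gva_mode_gen]), the Borcherds identity for n = - g says that
    (1 - w/z)^(- g) B(z) B(w) is symmetric in z and w ([bmode_loc]).  Hence the
    series
      X(z_1, ..., z_r) = prod_(i < j) (1 - z_j / z_i)^(- g) B(z_1) ... B(z_r) v
    is symmetric, and it has no negative powers of z_r, hence none of any z_i
    ([sym_vecz_lt0], [perm_sym_vec]).  So its coefficients are indexed by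
    multisets of r natural numbers.  Multiplying by the inverse factors
    expresses the modes of b on these coefficients through coefficients of the
    same kind ([mode_sym_vec_closed]).  Their span is therefore stable under b,
    and by the Borcherds identity under the whole of F, so it is M
    ([modspan_full]).

    Their images.  The field of e^beta is a product of a creating and an
    annihilating exponential.  Moving the latter to the right produces exactly
    the factors (1 - z_j / z_i)^g ([normal_order], [vertex_exp_hvec]), which
    cancel those of X.  Thus chi takes the coefficient of
    z_1^(n_1) ... z_r^(n_r) in X to
      h_(n_1) ... h_(n_r) e^(m beta/g + r beta),
    where h_n is the complete symmetric function in the power sums
    p_k = beta(-k) ([chi_val_modvec]).

    Independence.  The operator beta(N+1)/g is a derivation with
    h_n |-> h_(n-N-1), so it is d/dh_(N+1) on polynomials in h_0, ..., h_(N+1).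
    This gives the algebraic independence of h_1, h_2, ...; the number of
    factors h_0 = 1 is determined by r, that is, by the Fock space in which the
    image lies ([hcomb_inj]). *)

(** * Linear maps, subspaces and triangular sums *)

Section LinearMaps.
Variables (K : pzRingType) (U V : lmodType K) (f : U -> V).
Hypothesis lin : is_linear f.

Lemma is_linear0 : f 0 = 0.
Proof. by have := lin (-1) 0 0; rewrite scaler0 addr0 scaleN1r addNr. Qed.

Lemma is_linearD x y : f (x + y) = f x + f y.
Proof. by have := lin 1 x y; rewrite !scale1r. Qed.

Lemma is_linearZ a x : f (a *: x) = a *: f x.
Proof. by have := lin a x 0; rewrite !addr0 is_linear0 addr0. Qed.

Lemma is_linearB x y : f (x - y) = f x - f y.
Proof. by rewrite is_linearD -scaleN1r is_linearZ scaleN1r. Qed.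

Lemma is_linear_sum I (r : seq I) (P : pred I) F :
  f (\sum_(i <- r | P i) F i) = \sum_(i <- r | P i) f (F i).
Proof. exact: (big_morph f is_linearD is_linear0). Qed.

End LinearMaps.

Section Subspaces.
Variables (K : pzRingType) (V : lmodType K) (P : set V).
Hypothesis Psub : subspace P.

Lemma subspace0 : P 0. Proof. exact: Psub.1. Qed.

Lemma subspaceD x y : P x -> P y -> P (x + y).
Proof. by move=> Px Py; rewrite -[x]scale1r; apply: Psub.2. Qed.

Lemma subspaceZ a x : P x -> P (a *: x).
Proof. by move=> Px; rewrite -[_ *: _]addr0; apply: Psub.2 => //; apply: Psub.1. Qed.

Lemma subspaceB x y : P x -> P y -> P (x - y).
Proof. by move=> Px Py; rewrite -scaleN1r; apply/subspaceD/subspaceZ. Qed.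

Lemma subspace_sum (I : eqType) (r : seq I) (F : I -> V) :
  (forall i, i \in r -> P (F i)) -> P (\sum_(i <- r) F i).
Proof.
move=> PF; rewrite big_seq; elim/big_ind: _ => //; first exact: subspace0.
exact: subspaceD.
Qed.

End Subspaces.

Lemma sum_triangleC (V : nmodType) (F : nat -> nat -> V) m n : (m <= n)%N ->
  \sum_(i < n) \sum_(j < m - i) F i j = \sum_(j < n) \sum_(i < m - j) F i j.
Proof.
move=> lemn; pose G i j := if (i + j < m)%N then F i j else 0.
transitivity (\sum_(i < n) \sum_(j < n) G i j).
  apply: eq_bigr => i _; rewrite (big_ord_widen n) ?(leq_trans (leq_subr _ _)) //.
  by rewrite big_mkcond; apply: eq_bigr => j _; rewrite /G ltn_subRL.
rewrite exchange_big /=; apply: eq_bigr => j _.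
rewrite [RHS](big_ord_widen n (fun i => F i j)) ?(leq_trans (leq_subr _ _)) //.
by rewrite [RHS]big_mkcond; apply: eq_bigr => i _; rewrite /G ltn_subRL addnC.
Qed.

Lemma sum_triangleSC (V : nmodType) (F : nat -> nat -> V) n :
  \sum_(i < n.+1) \sum_(j < (n - i).+1) F i j =
  \sum_(j < n.+1) \sum_(i < (n - j).+1) F i j.
Proof.
have Sn (F' : nat -> nat -> V) : \sum_(i < n.+1) \sum_(j < (n - i).+1) F' i j =
    \sum_(i < n.+1) \sum_(j < n.+1 - i) F' i j :> V.
  by apply: eq_bigr => i _; rewrite subSn ?leq_ord.
by rewrite Sn sum_triangleC // -(Sn (fun j i => F i j)).
Qed.

Lemma sum_triangle (V : nmodType) (F : nat -> nat -> V) n :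
  \sum_(i < n.+1) \sum_(j < (n - i).+1) F i j =
  \sum_(k < n.+1) \sum_(i < k.+1) F i (k - i)%N.
Proof.
elim: n => [|n IHn]; first by rewrite !big_ord1.
rewrite [RHS]big_ord_recr -IHn /= [LHS]big_ord_recr /= subnn big_ord1.
rewrite [X in _ = _ + X]big_ord_recr /= subnn addrA; congr (_ + _).
rewrite -big_split /=; apply: eq_bigr => i _.
by rewrite subSn ?big_ord_recr //; have := ltn_ord i.
Qed.

(** * The binomial series *)

Section BinomialSeries.
Variables (K : numDomainType) (a : K) (c d : nat -> K).
Hypotheses (c0 : c 0%N = 1) (d0 : d 0%N = 1).
Hypothesis cS : forall i, i.+1%:R * c i.+1 = (a + i%:R) * c i.
Hypothesis dS : forall i, i.+1%:R * d i.+1 = (- a + i%:R) * d i.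

(** The recursions are those of (1 - t)^(- a) and (1 - t)^a.  They give
    n e_n = (n - 1) e_(n-1) for the coefficients e_n of the product. *)
Lemma binomial_series_inv n :
  \sum_(i < n.+1) c i * d (n - i)%N = (n == 0%N)%:R.
Proof.
elim: n => [|n IHn]; first by rewrite big_ord1 c0 d0 mulr1.
apply: (@mulfI _ n.+1%:R); first by rewrite pnatr_eq0.
transitivity (n%:R * \sum_(i < n.+1) c i * d (n - i)%N); last first.
  by rewrite IHn; case: n {IHn} => [|n]; rewrite ?mul0r ?mulr0.
have -> : n.+1%:R * (\sum_(i < n.+2) c i * d (n.+1 - i)%N) =
    \sum_(i < n.+2) i%:R * c i * d (n.+1 - i)%N +
    \sum_(i < n.+2) c i * ((n.+1 - i)%N%:R * d (n.+1 - i)%N).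
  rewrite mulr_sumr -big_split /=; apply: eq_bigr => i _.
  by rewrite natrB ?leq_ord //; ring.
rewrite big_ord_recl /= !mul0r add0r [X in _ + X]big_ord_recr /= subnn mul0r.
rewrite mulr0 addr0 -big_split mulr_sumr /=; apply: eq_bigr => i _.
have lein := leq_ord i.
rewrite /bump leq0n add1n subSS cS subSn // dS natrB //; ring.
Qed.

(** The coefficient form of t f' = - a t / (1 - t) f for f = (1 - t)^a. *)
Lemma binomial_series_partial n : n%:R * d n = - a * \sum_(i < n) d i.
Proof.
elim: n => [|n IHn]; first by rewrite mul0r big_ord0 mulr0.
by rewrite dS mulrDl IHn big_ord_recr /=; ring.
Qed.

End BinomialSeries.

(** * Multiplying a series by a product of one-variable factors *)

Section ShiftSum.
Variable K : comPzRingType.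
Implicit Types (c d : nat -> K) (s : seq nat).

(** For s = (s_1, ..., s_r) this is the sum over all I <= s of
    c_(I_1) ... c_(I_r) G (I_1 + ... + I_r) (s - I).  When G n u is the
    coefficient of z_0^n z_1^(u_1) ... z_r^(u_r) in a series, up to a
    translation of n, it is a coefficient of the product of that series with
    all f(z_j / z_0), where f(t) is the sum of the c_i t^i: exponents move from
    the z_j to z_0. *)
Fixpoint shift_sum (U : lmodType K) c (G : nat -> seq nat -> U) s : U :=
  if s is n :: s' then
    \sum_(i < n.+1) c i *:
      shift_sum c (fun t u => G (i + t)%N ((n - i)%N :: u)) s'
  else G 0%N [::].

Lemma eq_shift_sum (U : lmodType K) c (G G' : nat -> seq nat -> U) s :
    (forall t u, size u = size s -> (t + sumn u)%N = sumn s ->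
      G t u = G' t u) ->
  shift_sum c G s = shift_sum c G' s.
Proof.
elim: s G G' => [|n s IHs] G G' eqG /=; first exact: eqG.
apply: eq_bigr => i _; congr (_ *: _); apply: IHs => t u szu sumu.
by apply: eqG => /=; [rewrite szu | have := ltn_ord i; lia].
Qed.

Lemma shift_sum_eq0 (U : lmodType K) c (G : nat -> seq nat -> U) s :
    (forall t u, size u = size s -> (t + sumn u)%N = sumn s -> G t u = 0) ->
  shift_sum c G s = 0.
Proof.
elim: s G => [|n s IHs] G G0 /=; first exact: G0.
rewrite big1 // => i _; rewrite IHs ?scaler0 // => t u szu sumu.
by apply: G0 => /=; [rewrite szu | have := ltn_ord i; lia].
Qed.

Lemma linear_shift_sum (U V : lmodType K) (f : U -> V) c G s :
  is_linear f -> f (shift_sum c G s) = shift_sum c (fun t u => f (G t u)) s.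
Proof.
move=> linf; elim: s G => [|n s IHs] G //=.
rewrite (is_linear_sum linf); apply: eq_bigr => i _.
by rewrite (is_linearZ linf) IHs.
Qed.

Lemma shift_sum_sum (U : lmodType K) c n (a : nat -> K)
    (G : nat -> nat -> seq nat -> U) s :
  shift_sum c (fun t u => \sum_(i < n) a i *: G i t u) s =
  \sum_(i < n) a i *: shift_sum c (G i) s.
Proof.
elim: s G => [|k s IHs] G //=.
under eq_bigr do rewrite (IHs (fun i t u => G i (_ + t)%N (_ :: u))) scaler_sumr.
rewrite exchange_big /=; apply: eq_bigr => i _; rewrite scaler_sumr.
by apply: eq_bigr => j _; rewrite !scalerA mulrC.
Qed.

Lemma subspace_shift_sum (U : lmodType K) (P : set U) c G s :
    subspace P ->
    (forall t u, size u = size s -> (t + sumn u)%N = sumn s -> P (G t u)) ->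
  P (shift_sum c G s).
Proof.
move=> Psub; elim: s G => [|n s IHs] G PG /=; first exact: PG.
apply: (subspace_sum Psub) => i _; apply: (subspaceZ Psub).
apply: IHs => t u szu sumu.
by apply: PG => /=; [rewrite szu | have := ltn_ord i; lia].
Qed.

Lemma shift_sumC (U : lmodType K) c d (G : nat -> nat -> seq nat -> U) s :
  shift_sum c (fun t u => shift_sum d (fun t' u' => G t t' u') u) s =
  shift_sum d (fun t' u => shift_sum c (fun t u' => G t t' u') u) s.
Proof.
elim: s G => [|n s IHs] G //=.
transitivity (\sum_(i < n.+1) \sum_(j < (n - i).+1) (c i * d j) *:
    shift_sum d (fun t' u => shift_sum c (fun t u' =>
      G (i + t)%N (j + t')%N ((n - (i + j))%N :: u')) u) s).
  apply: eq_bigr => i _.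
  rewrite (shift_sum_sum _ _ d (fun j t u =>
    shift_sum d (fun t' u' => G _ (j + t')%N (_ - j :: u')%N) u)) scaler_sumr.
  apply: eq_bigr => j _; rewrite scalerA IHs; congr (_ *: _).
  by apply: eq_shift_sum => t u _ _; apply: eq_shift_sum => *; rewrite subnDA.
rewrite (sum_triangleSC (fun i j => (c i * d j) *: shift_sum d (fun t' u =>
  shift_sum c (fun t u' => G (i + t)%N (j + t')%N ((n - (i + j))%N :: u')) u) s)).
apply: eq_bigr => j _.
rewrite (shift_sum_sum _ _ c (fun i t u =>
  shift_sum c (fun t' u' => G (i + t')%N _ (_ - i :: u')%N) u)) scaler_sumr.
apply: eq_bigr => i _; rewrite scalerA mulrC; congr (_ *: _).
apply: eq_shift_sum => t u _ _; apply: eq_shift_sum => *.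
by rewrite [(i + j)%N]addnC subnDA.
Qed.

(** Multiplication by all f(z_j / z_0) is undone by multiplication by all
    f(z_j / z_0)^(-1). *)
Lemma shift_sum_inv (U : lmodType K) c d (G : nat -> seq nat -> U) s :
    (forall n, \sum_(i < n.+1) c i * d (n - i)%N = (n == 0%N)%:R) ->
  shift_sum c (fun t u => shift_sum d (fun t' u' => G (t + t')%N u') u) s =
  G 0%N s.
Proof.
move=> cd; elim: s G => [|n s IHs] G //=.
transitivity (\sum_(i < n.+1) \sum_(j < (n - i).+1) (c i * d j) *:
    G (i + j)%N ((n - (i + j))%N :: s)).
  apply: eq_bigr => i _.
  rewrite (shift_sum_sum _ _ d (fun j t u =>
    shift_sum d (fun t' u' => G (_ + (j + t'))%N (_ - j :: u')%N) u)).
  rewrite scaler_sumr; apply: eq_bigr => j _; rewrite scalerA; congr (_ *: _).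
  have := IHs (fun t u =>
    G (val i + val j + t)%N ((n - (val i + val j))%N :: u)).
  rewrite addn0 => <-.
  apply: eq_shift_sum => t u _ _; apply: eq_shift_sum => t' u' _ _.
  by rewrite addnACA subnDA.
rewrite (sum_triangle (fun i j =>
  (c i * d j) *: G (i + j)%N ((n - (i + j))%N :: s))).
transitivity (\sum_(k < n.+1) (k == 0%N :> nat)%:R *: G k ((n - k)%N :: s)).
  apply: eq_bigr => k _; rewrite -cd scaler_suml; apply: eq_bigr => i _.
  by rewrite subnKC // -ltnS.
rewrite big_ord_recl /= scale1r subn0 big1 ?addr0 // => i _.
by rewrite scale0r.
Qed.

End ShiftSum.

(** * Symmetric combinations of modes *)

(** Transpositions of neighbours generate all permutations. *)
Lemma perm_ind_swap (T : eqType) (Q : seq T -> seq T -> Prop) :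
    (forall s, Q s s) ->
    (forall s1 s2 s3, Q s1 s2 -> Q s2 s3 -> Q s1 s3) ->
    (forall a b s, Q (a :: b :: s) (b :: a :: s)) ->
    (forall a s s', perm_eq s s' -> Q s s' -> Q (a :: s) (a :: s')) ->
  forall s s', perm_eq s s' -> Q s s'.
Proof.
move=> Qrefl Qtrans Qswap Qcons; elim=> [|a s IHs] s'.
  by rewrite perm_sym => /perm_nilP ->.
move=> eqss'; have: a \in s' by rewrite -(perm_mem eqss') mem_head.
move=> /splitPr as_s'; case: as_s' eqss' => p1 p2 eqss'.
have {}eqss' : perm_eq s (p1 ++ p2).
  by rewrite -(perm_cons a) (permPl eqss') -cat1s perm_catCA.
apply: (Qtrans _ (a :: p1 ++ p2)); first exact/Qcons/IHs.
elim: p1 {IHs eqss'} => [|b p1 IHp] //=.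
apply: Qtrans (Qswap _ _ _) _; apply: Qcons => //.
by rewrite -cat1s perm_catCA.
Qed.

Lemma perm_shift_sum (K : comPzRingType) (U : lmodType K) c
    (G : nat -> seq nat -> U) s s' :
    (forall t u u', size u = size s -> perm_eq u u' -> G t u = G t u') ->
  perm_eq s s' -> shift_sum c G s = shift_sum c G s'.
Proof.
move=> permG eqss'; move: permG.
pose Q s s' := size s = size s' /\ forall G : nat -> seq nat -> U,
  (forall t u u', size u = size s -> perm_eq u u' -> G t u = G t u') ->
  shift_sum c G s = shift_sum c G s'.
suff [_ Qss'] : Q s s' by move=> permG; exact: Qss'.
apply: perm_ind_swap eqss' => {s s' G} [s|s1 s2 s3 []|a b s|a s s' eqss'].
- by split.
- move=> sz12 eq12 [sz23 eq23]; split=> [|G permG]; first by rewrite sz12.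
  by rewrite eq12 // eq23 // -sz12.
- split=> //= G permG.
  under eq_bigr do rewrite scaler_sumr.
  under [RHS]eq_bigr do rewrite scaler_sumr.
  rewrite exchange_big /=; apply: eq_bigr => j _; apply: eq_bigr => i _.
  rewrite !scalerA mulrC; congr (_ *: _); apply: eq_shift_sum => t u szu _.
  rewrite addnCA; apply: permG; first by rewrite /= szu.
  by rewrite -[_ :: _ :: u]/([:: _] ++ [:: _] ++ u) perm_catCA.
- move=> [szs eqs]; split=> [|G permG] /=; first by rewrite szs.
  apply: eq_bigr => i _; congr (_ *: _); apply: eqs => t u u' szu equ.
  by apply: permG; rewrite /= ?szu ?perm_cons.
Qed.

Section SymmetricModes.
Variables (K : comPzRingType) (U : lmodType K) (c d : nat -> K).
Hypothesis dc : forall n, \sum_(i < n.+1) d i * c (n - i)%N = (n == 0%N)%:R.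
Variables (P : nat -> set U) (B : nat -> int -> U -> U) (v : U).
Hypothesis Psub : forall r, subspace (P r).
Hypothesis Pv : P 0%N v.
Hypothesis PB : forall r k x, P r x -> P r.+1 (B r k x).
Hypothesis Blin : forall r k, is_linear (B r k).
Hypothesis Bv : forall k, k < 0 -> B 0%N k v = 0.
Hypothesis Bloc : forall r x k l N, P r x ->
    (forall i, (N <= i)%N ->
       B r (k - i%:Z) x = 0 /\ B r (l - i%:Z) x = 0) ->
  \sum_(i < N) c i *: B r.+1 (k + i%:Z) (B r (l - i%:Z) x) =
  \sum_(i < N) c i *: B r.+1 (l + i%:Z) (B r (k - i%:Z) x).

(** [sym_rec r s] is the coefficient of z_1^(s_1) ... z_r^(s_r) in
      prod_(i < j) f(z_j / z_i) B(z_1) ... B(z_r) v,   f(t) = sum_i c_i t^i.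
    The factors f(z_j / z_i) turn locality into symmetry in z_1, ..., z_r. *)
Fixpoint sym_rec (r : nat) (s : seq nat) : U :=
  match r, s with
  | r'.+1, n :: s' => shift_sum c (fun t u => B r' (n + t)%N (sym_rec r' u)) s'
  | _, _ => v
  end.

Definition sym_vec s := sym_rec (size s) s.

(** The same coefficient with a first exponent that may be negative; it
    vanishes then, which is the content of [sym_vecz_lt0]. *)
Definition sym_vecz (n : int) s :=
  shift_sum c (fun t u => B (size s) (n + t%:Z) (sym_vec u)) s.

Lemma sym_vec_cons n s : sym_vec (n :: s) = sym_vecz n s.
Proof.
by apply: eq_shift_sum => t u szu _; rewrite /sym_vec szu.
Qed.

Lemma sym_vec_deg s : P (size s) (sym_vec s).
Proof.
move: {2}(size s) (erefl (size s)) => r; elim: r s => [|r IHr] [|n s] //= [szs].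
rewrite sym_vec_cons; apply: subspace_shift_sum => // t u szu _.
by apply: PB; rewrite -szu; apply: IHr; rewrite szu.
Qed.

(** The inverse of the recursion for [sym_vec]: it writes the modes of these
    vectors in terms of these vectors again. *)
Lemma mode_sym_vec k s :
  B (size s) k (sym_vec s) =
  shift_sum d (fun t u => sym_vecz (k + t%:Z) u) s.
Proof.
rewrite -[in LHS](addr0 k) -[X in _ + X]/(0%N%:Z).
rewrite -[LHS](shift_sum_inv (fun t u => B (size s) (k + t%:Z) (sym_vec u)) s dc).
apply: eq_shift_sum => t u szu _; apply: eq_shift_sum => t' u' _ _.
by rewrite szu PoszD addrA.
Qed.

Definition sym_vecz_bounded r :=
  forall n s, size s = r -> n < 0 -> sym_vecz n s = 0.

Lemma mode_sym_vec0 k s :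
  sym_vecz_bounded (size s) -> k + (sumn s)%:Z < 0 -> B (size s) k (sym_vec s) = 0.
Proof.
move=> lbs ks; rewrite mode_sym_vec; apply: shift_sum_eq0 => t u szu sumu.
by apply: lbs => //; lia.
Qed.

(** The coefficient with first two exponents n and k, written with the two
    outer modes side by side so that locality exchanges n and k.  The factor
    f(z_2 / z_1) is cut off after N terms. *)
Definition sym_vec2 N (n k : int) s :=
  shift_sum c (fun t u => \sum_(i < N)
    c i *: B (size s).+1 (n + t%:Z + i%:Z) (sym_vecz (k - i%:Z) u)) s.

Lemma sym_vecz_cons N n k s :
    sym_vecz_bounded (size s) -> (k < N)%N ->
  sym_vecz n (k :: s) = sym_vec2 N n k s.
Proof.
move=> lbs ltkN; rewrite /sym_vecz /sym_vec2 /=.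
rewrite -(shift_sum_sum _ _ c (fun i t u => B (size s).+1 (n + (i + t)%N%:Z)
  (sym_vec ((k - i)%N :: u)))).
apply: eq_shift_sum => t u szu _.
rewrite (big_ord_widen _ (fun i => c i *: B (size s).+1 (n + (i + t)%N%:Z)
  (sym_vec ((k - i)%N :: u))) ltkN) big_mkcond /=.
apply: eq_bigr => i _; case: ifP => [leik|ltki].
  rewrite sym_vec_cons -(@subzn k i leik).
  by rewrite addnC PoszD addrA.
rewrite (lbs (k%:Z - i%:Z)) ?(is_linear0 (Blin _ _)) ?scaler0 //.
by lia.
Qed.

Lemma sym_vec2C N n k s :
    sym_vecz_bounded (size s) ->
    n + (sumn s)%:Z < N%:Z -> k + (sumn s)%:Z < N%:Z ->
  sym_vec2 N n k s = sym_vec2 N k n s.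
Proof.
move=> lbs ltnN ltkN.
have expand n' k' : sym_vec2 N n' k' s = shift_sum c (fun t u =>
    shift_sum c (fun t' u' => \sum_(i < N) c i *: B (size s).+1
      (n' + t%:Z + i%:Z) (B (size s) (k' + t'%:Z - i%:Z) (sym_vec u'))) u) s.
  apply: eq_shift_sum => t u szu _.
  rewrite (shift_sum_sum _ _ c (fun i t' u' => B (size s).+1
      (n' + t%:Z + i%:Z) (B (size s) (k' + t'%:Z - i%:Z) (sym_vec u')))).
  apply: eq_bigr => i _; rewrite (linear_shift_sum _ _ _ (Blin _ _)).
  congr (_ *: _); rewrite szu; apply: eq_shift_sum => t' u' _ _.
  by rewrite [k' - _ + _]addrAC.
rewrite !expand [RHS]shift_sumC; apply: eq_shift_sum => t u szu sumu.
apply: eq_shift_sum => t' u' szu' sumu'.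
have Eu' : size u' = size s by rewrite szu'.
rewrite -Eu'; apply: Bloc => [|i leNi]; first exact: sym_vec_deg.
by split; apply: mode_sym_vec0; rewrite ?Eu' //; lia.
Qed.

(** B(z) v has no negative powers of z, so there are none of the last variable,
    and none of the first one by symmetry.  The symmetry in the first two
    variables is about finite sums only if there are no negative powers in
    fewer variables, hence the induction. *)
Lemma sym_vecz_lt0 r : sym_vecz_bounded r.
Proof.
elim: r => [|r IHr] n s.
  by case: s => // _ n0; rewrite /sym_vecz /= addr0 Bv.
case: s => // k s [szs] n0; rewrite -szs in IHr.
have [N ltnN [ltkN ltN]] : exists2 N : nat, n + (sumn s)%:Z < N%:Z &
    k%:Z + (sumn s)%:Z < N%:Z /\ (k < N)%N.
  by exists (k + sumn s).+1; [lia | split; lia].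
rewrite (@sym_vecz_cons N) // sym_vec2C //; apply: shift_sum_eq0 => t u szu _.
rewrite big1 // => i _; rewrite IHr ?(is_linear0 (Blin _ _)) ?scaler0 //.
by lia.
Qed.

Lemma sym_vec_swap n k s : sym_vec (n :: k :: s) = sym_vec (k :: n :: s).
Proof.
pose N := (k + n + sumn s).+1.
rewrite !sym_vec_cons !(@sym_vecz_cons N) ?/N; try lia; try exact: sym_vecz_lt0.
by apply: sym_vec2C; [exact: sym_vecz_lt0 | lia | lia].
Qed.

Lemma perm_sym_vec s s' : perm_eq s s' -> sym_vec s = sym_vec s'.
Proof.
elim: {s}(size s).+1 {-2}s (ltnSn (size s)) s' => // r IHr s szs s' eqss'.
pose Q s s' := size s = size s' /\ ((size s < r.+1)%N -> sym_vec s = sym_vec s').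
suff [_ ->] : Q s s' by [].
apply: perm_ind_swap eqss' => {s s' szs} [s|s1 s2 s3 []|a b s|a s s' eqss' []].
- by split.
- move=> sz12 eq12 [sz23 eq23]; split=> [|lts1]; first by rewrite sz12.
  by rewrite eq12 // eq23 // -sz12.
- by split=> // _; apply: sym_vec_swap.
- move=> szs _; split=> /= [|lts]; first by rewrite szs.
  rewrite !sym_vec_cons /sym_vecz -szs; apply: perm_shift_sum eqss'.
  by move=> t u u' szu equ; rewrite (IHr u _ u') ?szu.
Qed.

(** Only the vectors with nonnegative exponents survive in [mode_sym_vec], so
    their span is stable under all modes. *)
Lemma mode_sym_vec_closed (T : set U) k s :
    subspace T -> (forall u, T (sym_vec u)) -> T (B (size s) k (sym_vec s)).
Proof.
move=> Tsub TX; rewrite mode_sym_vec; apply: subspace_shift_sum => // t u _ _.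
case: (ltP (k + t%:Z) 0) => [kt0|]; last first.
  by case: (k + t%:Z) => // n _; rewrite -sym_vec_cons.
by rewrite (@sym_vecz_lt0 (size u)) //; case: Tsub.
Qed.

End SymmetricModes.

(** * Linear extension from a basis *)

Section MalgExtension.
Variables (K : choiceType) (R : nzRingType) (V : lmodType R).
Implicit Types (f : K -> V) (u : malg K R).

Definition malg_ext f u : V :=
  \sum_(x <- msupp u) mcoeff x u *: f x.

Lemma malg_extEw f u (D : {fset K}) : (msupp u `<=` D)%fset ->
  malg_ext f u = \sum_(x <- D) mcoeff x u *: f x.
Proof.
move=> suD; rewrite /malg_ext (big_fset_incl _ suD) // => x _ xu.
by rewrite mcoeff_outdom // scale0r.
Qed.

Lemma malg_ext_linear f : is_linear (malg_ext f).
Proof.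
move=> a u w; pose D := (msupp (a *: u + w) `|` (msupp u `|` msupp w))%fset.
have [sauw su sw] : [/\ (msupp (a *: u + w) `<=` D)%fset, (msupp u `<=` D)%fset
    & (msupp w `<=` D)%fset].
  by split; apply/fsubsetP => x; rewrite !in_fsetU => ->; rewrite ?orbT.
rewrite (malg_extEw f sauw) (malg_extEw f su) (malg_extEw f sw).
rewrite scaler_sumr -big_split; apply: eq_bigr => x _ /=.
by rewrite mcoeffD mcoeffZ scalerDl scalerA.
Qed.

Lemma malg_extU f x : malg_ext f (mkmalgU x 1) = f x.
Proof. by rewrite /malg_ext msuppU oner_eq0 big_seq_fset1 mcoeffUU scale1r. Qed.

Lemma malg_basisE u : u = \sum_(x <- msupp u) mcoeff x u *: mkmalgU x 1.
Proof.
rewrite [LHS]monalgE; apply: eq_bigr => x _.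
by apply/malgP => y; rewrite mcoeffZ !mcoeffU mulrnAr mulr1.
Qed.

Lemma linear_malgE (f : malg K R -> V) u :
  is_linear f -> f u = malg_ext (fun x => f (mkmalgU x 1)) u.
Proof.
move=> linf; rewrite {1}[u]malg_basisE (is_linear_sum linf).
by apply: eq_bigr => x _; rewrite (is_linearZ linf).
Qed.

Lemma linear_malg_ext (f f' : malg K R -> V) : is_linear f -> is_linear f' ->
  (forall x, f (mkmalgU x 1) = f' (mkmalgU x 1)) -> f =1 f'.
Proof.
move=> linf linf' eqf u; rewrite (linear_malgE u linf) (linear_malgE u linf').
by apply: eq_bigr => x _; rewrite eqf.
Qed.

End MalgExtension.

Section LinearOps.
Variables (K : comPzRingType) (U V W : lmodType K).

Lemma is_linear_comp (f : V -> W) (g : U -> V) :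
  is_linear f -> is_linear g -> is_linear (fun x => f (g x)).
Proof. by move=> lf lg a x y; rewrite lg lf. Qed.

Lemma is_linear_scale (f : U -> V) b :
  is_linear f -> is_linear (fun x => b *: f x).
Proof. by move=> lf a x y; rewrite lf scalerDr !scalerA mulrC. Qed.

Lemma is_linear_bigsum I (r : seq I) (P : pred I) (F : I -> U -> V) :
  (forall i, is_linear (F i)) -> is_linear (fun x => \sum_(i <- r | P i) F i x).
Proof.
move=> lF a x y; rewrite scaler_sumr -big_split; apply: eq_bigr => i _.
exact: lF.
Qed.

Lemma is_linear_add (f g : U -> V) :
  is_linear f -> is_linear g -> is_linear (fun x => f x + g x).
Proof. by move=> lf lg a x y; rewrite lf lg scalerDr addrACA. Qed.

Lemma is_linear_id : is_linear (fun x : U => x).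
Proof. by []. Qed.

Lemma is_linear_cst0 : is_linear (fun x : U => 0 : V).
Proof. by move=> a x y; rewrite scaler0 addr0. Qed.

End LinearOps.

(** * Exponentials of commuting operators *)

Section ExpCoef.
Variables (R : realType) (h : vectType R[i]).
Local Notation fock := (fock h).
Implicit Types (v w : fock).
Variable T : nat -> fock -> fock.
Hypothesis Tlin : forall k, is_linear (T k).
Hypothesis TC : forall k l v, T k (T l v) = T l (T k v).

Lemma pow_coef_linear r j : is_linear (pow_coef T r j).
Proof.
elim: r j => [|r IHr] j /=.
  by case: (j == 0%N); [exact: is_linear_id | exact: is_linear_cst0].
by apply: is_linear_bigsum => k; apply: is_linear_comp.
Qed.

Lemma exp_coef_linear j : is_linear (exp_coef T j).
Proof.
apply: is_linear_bigsum => r; apply: is_linear_scale; exact: pow_coef_linear.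
Qed.

Lemma pow_coef_gt r j v : (j < r)%N -> pow_coef T r j v = 0.
Proof.
elim: r j => [|r IHr] j //= ltjr; rewrite big1 // => k _.
by rewrite IHr ?(is_linear0 (Tlin _)) //; have := ltn_ord k; lia.
Qed.

(** As the T_k commute, t d/dt takes T(t)^(r+1) to (r+1) (t T'(t)) T(t)^r. *)
Lemma pow_coef_deriv r j v :
  j%:R *: pow_coef T r.+1 j v =
  r.+1%:R *: \sum_(k < j) k.+1%:R *: T k (pow_coef T r (j - k.+1)%N v).
Proof.
elim: r j v => [|r IHr] j v.
  rewrite /= !scaler_sumr; apply: eq_bigr => k _; rewrite scale1r.
  case: eqP => jk; last by rewrite (is_linear0 (Tlin _)) !scaler0.
  by congr (_%:R *: _); have := ltn_ord k; lia.
have -> : j%:R *: pow_coef T r.+2 j v =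
    \sum_(k < j) k.+1%:R *: T k (pow_coef T r.+1 (j - k.+1)%N v) +
    \sum_(k < j) T k ((j - k.+1)%:R *: pow_coef T r.+1 (j - k.+1)%N v).
  rewrite -big_split [pow_coef]lock /= -lock [in LHS]/= scaler_sumr.
  apply: eq_bigr => k _; rewrite (is_linearZ (Tlin _)) -scalerDl -natrD.
  by rewrite subnKC.
have -> : \sum_(k < j) T k ((j - k.+1)%:R *: pow_coef T r.+1 (j - k.+1)%N v) =
    r.+1%:R *: \sum_(k < j) k.+1%:R *: T k (pow_coef T r.+1 (j - k.+1)%N v).
  transitivity (\sum_(k < j) \sum_(l < j.-1 - k) (r.+1 * l.+1)%:R *:
      T k (T l (pow_coef T r (j - k.+1 - l.+1)%N v))).
    apply: eq_bigr => k _; rewrite IHr (is_linearZ (Tlin _)).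
    rewrite (is_linear_sum (Tlin _)) scaler_sumr -predn_sub -subnS.
    by apply: eq_bigr => l _; rewrite (is_linearZ (Tlin _)) scalerA natrM.
  rewrite (sum_triangleC (fun k l => (r.+1 * l.+1)%:R *:
      T k (T l (pow_coef T r (j - k.+1 - l.+1)%N v))) (leq_pred _)).
  rewrite scaler_sumr; apply: eq_bigr => l _ /=.
  rewrite (is_linear_sum (Tlin _)) scalerA scaler_sumr -predn_sub -subnS.
  apply: eq_bigr => k _; rewrite natrM TC; congr (_ *: T _ (T _ _)).
  by rewrite subnAC.
by rewrite -{1}[\sum_(k < j) _]scale1r -scalerDl -[1]/(1%:R) -natrD.
Qed.

Lemma exp_coef0 v : exp_coef T 0 v = v.
Proof. by rewrite /exp_coef big_ord1 /= fact0 invr1 scale1r. Qed.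

(** The coefficient form of t E'(t) = (t T'(t)) E(t) for E = exp T.  Together
    with E(0) = 1 it determines E, and it replaces the definition of E from
    here on. *)
Lemma exp_coef_deriv j v :
  j.+1%:R *: exp_coef T j.+1 v =
  \sum_(k < j.+1) k.+1%:R *: T k (exp_coef T (j - k)%N v).
Proof.
transitivity (\sum_(k < j.+1) k.+1%:R *: T k (\sum_(r < j.+1)
    r`!%:R^-1 *: pow_coef T r (j - k)%N v)); last first.
  apply: eq_bigr => k _; congr (_ *: T _ _).
  rewrite /exp_coef [RHS](big_ord_widen j.+1 (fun r =>
    r`!%:R^-1 *: pow_coef T r (j - k)%N v)) ?ltnS ?leq_subr //.
  rewrite [RHS]big_mkcond /=; apply: eq_bigr => r _; case: ifP => // /negbT.
  by rewrite -leqNgt => /pow_coef_gt ->; rewrite scaler0.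
rewrite /exp_coef big_ord_recl /= scaler0 add0r scaler_sumr.
transitivity (\sum_(r < j.+1) \sum_(k < j.+1) (r`!%:R^-1 * k.+1%:R) *:
    T k (pow_coef T r (j - k)%N v)); last first.
  rewrite exchange_big; apply: eq_bigr => k _ /=.
  rewrite (is_linear_sum (Tlin _)) scaler_sumr; apply: eq_bigr => r _.
  by rewrite (is_linearZ (Tlin _)) scalerA mulrC.
apply: eq_bigr => r _; rewrite /bump leq0n add1n.
rewrite scalerA mulrC -scalerA pow_coef_deriv scalerA scaler_sumr.
apply: eq_bigr => k _; rewrite scalerA subSS; congr (_ *: _).
rewrite factS natrM invfM [_ * r.+1%:R]mulrAC mulVf ?mul1r //.
by rewrite pnatr_eq0.
Qed.

Lemma subspace_exp_coef (P : set fock) j v : subspace P ->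
  (forall k w, P w -> P (T k w)) -> P v -> P (exp_coef T j v).
Proof.
move=> Psub PT Pv; apply: (subspace_sum Psub) => r _; apply: (subspaceZ Psub).
move: (nat_of_ord r) => {}r; elim: r j => [|r IHr] j /=.
  by case: ifP => // _; apply: (subspace0 Psub).
by apply: (subspace_sum Psub) => k _; apply: PT.
Qed.

(** If [D, T(t)] is a scalar series la(t), then [D, exp T(t)] = la(t) exp T(t). *)
Lemma exp_coef_comm (D : fock -> fock) (la : nat -> R[i]) j v :
    is_linear D -> (forall k w, D (T k w) = T k (D w) + la k *: w) ->
  D (exp_coef T j v) =
  exp_coef T j (D v) + \sum_(k < j) la k *: exp_coef T (j - k.+1)%N v.
Proof.
(* E(0) = 1 and the differential equation are all that is used of E. *)
move=> Dlin DT; have E0 := exp_coef0; have ES := exp_coef_deriv.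
move: (exp_coef T) E0 ES => E E0 ES.
elim/ltn_ind: j v => -[|j] IHj v.
  by rewrite !E0 big_ord0 addr0.
apply: (@scalerI _ _ j.+1%:R); first by rewrite pnatr_eq0.
rewrite -(is_linearZ Dlin) ES scalerDr ES.
rewrite (is_linear_sum Dlin).
have -> : \sum_(k < j.+1) D (k.+1%:R *: T k (E (j - k)%N v)) =
    \sum_(k < j.+1) k.+1%:R *: T k (E (j - k)%N (D v)) +
    (\sum_(k < j.+1) \sum_(l < j - k) (k.+1%:R * la l) *:
       T k (E (j - k - l.+1)%N v) +
     \sum_(k < j.+1) (k.+1%:R * la k) *: E (j - k)%N v).
  rewrite -!big_split /=; apply: eq_bigr => k _.
  rewrite (is_linearZ Dlin) DT IHj ?ltnS ?leq_subr // (is_linearD (Tlin _)).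
  rewrite !scalerDr scalerA (is_linear_sum (Tlin _)) -addrA.
  congr (_ + (_ + _)); rewrite scaler_sumr; apply: eq_bigr => l _.
  by rewrite (is_linearZ (Tlin _)) scalerA.
congr (_ + _).
rewrite (sum_triangleC (fun k l => (k.+1%:R * la l) *:
       T k (E (j - k - l.+1)%N v)) (leqnSn _)) -big_split /=.
rewrite scaler_sumr; apply: eq_bigr => l _; rewrite subSS.
have -> : \sum_(k < j - l) (k.+1%:R * la l) *: T k (E (j - k - l.+1)%N v) =
    la l *: ((j - l)%:R *: E (j - l)%N v).
  case Ejl : (j - l)%N => [|i]; first by rewrite big_ord0 scale0r scaler0.
  rewrite ES scaler_sumr; apply: eq_bigr => k _.
  by rewrite scalerA mulrC; congr (_ *: T _ (E _ _)); lia.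
rewrite !scalerA -scalerDl mulrC -mulrDl -natrD; congr ((_%:R * _) *: _).
by have := leq_ord l; lia.
Qed.

Lemma exp_coef_commute (D : fock -> fock) j v :
    is_linear D -> (forall k w, D (T k w) = T k (D w)) ->
  D (exp_coef T j v) = exp_coef T j (D v).
Proof.
move=> Dlin DT; rewrite (@exp_coef_comm D (fun=> 0)) // => [|k w].
  by rewrite big1 ?addr0 // => k _; rewrite scale0r.
by rewrite scale0r addr0.
Qed.

End ExpCoef.

(** * Heisenberg operators and their exponentials *)

(** The coefficient of t^i in (1 - t)^(- a). *)
Definition geom_coef (R : realType) (a : R[i]) (i : nat) : R[i] :=
  (-1) ^+ i * cbinom (- a) i.

Lemma geom_coef0 (R : realType) (a : R[i]) : geom_coef a 0 = 1.
Proof. by rewrite /geom_coef /cbinom big_ord0 fact0 divr1 mulr1. Qed.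

Lemma geom_coefS (R : realType) (a : R[i]) i :
  i.+1%:R * geom_coef a i.+1 = (a + i%:R) * geom_coef a i.
Proof.
have i1 : i.+1%:R != 0 :> R[i] by rewrite pnatr_eq0.
have i2 : i`!%:R != 0 :> R[i] by rewrite pnatr_eq0 -lt0n fact_gt0.
rewrite /geom_coef /cbinom big_ord_recr /= factS natrM exprS.
by field; rewrite nat1r i1 i2.
Qed.

Lemma geom_coef_inv (R : realType) (a : R[i]) n :
  \sum_(i < n.+1) geom_coef a i * geom_coef (- a) (n - i)%N = (n == 0%N)%:R.
Proof.
by apply: (@binomial_series_inv _ a); do ?[exact: geom_coef0|exact: geom_coefS].
Qed.

(** A Heisenberg pair: creation operators [c k] = beta(-k-1) and annihilation
    operators [a k] = beta(k+1), where g = (beta, beta). *)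
Record heis_pair (K : comNzRingType) (V : lmodType K) (g : K)
    (c a : nat -> V -> V) : Prop := HeisPair {
  cre_lin : forall k, is_linear (c k);
  ann_lin : forall k, is_linear (a k);
  creC : forall k l v, c k (c l v) = c l (c k v);
  annC : forall k l v, a k (a l v) = a l (a k v);
  ann_cre : forall k l v,
    a k (c l v) = c l (a k v) + ((k == l)%:R * (k.+1%:R * g)) *: v }.

Section PolynomialModel.
Variables (K : comNzRingType) (I : Type) (V : lmodType K).
Variables (fb : I -> {mset nat}%mset -> V) (g : K) (c a : nat -> V -> V).
Implicit Types (S : {mset nat}%mset).

(* Locked, because comparing multisets by computation is very slow. *)
Definition madd k S : {mset nat}%mset := locked (k +` S)%mset.
Definition mrem k S : {mset nat}%mset := locked (S `\ k)%mset.

Lemma maddE k S n : madd k S n = ((n == k) + S n)%N.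
Proof. by rewrite /madd -lock mset1DE. Qed.

Lemma mremE k S n : mrem k S n = (S n - (n == k))%N.
Proof. by rewrite /mrem -lock msetB1E. Qed.

Lemma maddC k l S : madd k (madd l S) = madd l (madd k S).
Proof. by apply/msetP => n; rewrite !maddE addnCA. Qed.

Lemma mremC k l S : mrem k (mrem l S) = mrem l (mrem k S).
Proof. by apply/msetP => n; rewrite !mremE subnAC. Qed.

Lemma maddK k S : mrem k (madd k S) = S.
Proof. by apply/msetP => n; rewrite mremE maddE addKn. Qed.

Lemma mremK k S : S k != 0%N -> madd k (mrem k S) = S.
Proof.
move=> Sk; apply/msetP => n; rewrite maddE mremE.
by have [->|_] := eqVneq n k; rewrite ?subn0 // subnKC // lt0n.
Qed.

Lemma mrem_madd k l S : k != l -> mrem k (madd l S) = madd l (mrem k S).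
Proof.
move=> nekl; apply/msetP => n; rewrite !(mremE, maddE).
by have [->|_] := eqVneq n k; rewrite ?(negPf nekl) ?subn0.
Qed.

Hypothesis fb_ext : forall f f' : V -> V, is_linear f -> is_linear f' ->
  (forall i S, f (fb i S) = f' (fb i S)) -> f =1 f'.
Hypotheses (clin : forall k, is_linear (c k)) (alin : forall k, is_linear (a k)).
Hypothesis c_fb : forall k i S, c k (fb i S) = fb i (madd k S).
Hypothesis a_fb : forall k i S,
  a k (fb i S) = (k.+1%:R * g * (S k)%:R) *: fb i (mrem k S).

(** In this model [c k] multiplies by the k-th variable, and [a k] is
    (k+1) g times the partial derivative in it. *)
Lemma polynomial_heis_pair : heis_pair g c a.
Proof.
split=> // k l v.
- move: v; apply: fb_ext => [||i S]; try exact: is_linear_comp.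
  by rewrite !c_fb maddC.
- have [->//|nekl] := eqVneq k l; move: v.
  apply: fb_ext => [||i S]; try exact: is_linear_comp.
  rewrite !a_fb !(is_linearZ (alin _)) !a_fb.
  rewrite !scalerA !mremE (negPf nekl) eq_sym (negPf nekl) !subn0 mremC.
  by congr (_ *: _); ring.
move: v; apply: fb_ext => [||i S]; first exact: is_linear_comp.
  apply: is_linear_add; last exact/is_linear_scale/is_linear_id.
  exact: is_linear_comp.
rewrite c_fb !a_fb (is_linearZ (clin _)) c_fb maddE.
have [->|nekl] := eqVneq k l; last first.
  by rewrite mul0r scale0r addr0 add0n mrem_madd.
rewrite maddK mul1r; have [Sl|Sl] := eqVneq (S l) 0%N.
  by rewrite Sl addn0 mulr0 scale0r add0r mulr1.
by rewrite mremK // -scalerDl natrD /=; congr (_ *: _); ring.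
Qed.

End PolynomialModel.

Section NormalOrder.
Variables (K : numFieldType) (V : lmodType K) (g : K) (d : nat -> K).
Variables (cre H : nat -> V -> V) (A : int -> V -> V).
Hypotheses (cre_linear : forall k, is_linear (cre k))
  (A_linear : forall z, is_linear (A z)).
Hypotheses (H0 : forall v, H 0%N v = v) (HS : forall n v,
  n.+1%:R *: H n.+1 v = \sum_(k < n.+1) cre k (H (n - k)%N v)).
Hypothesis A_cre : forall l z v,
  A z (cre l v) = cre l (A z v) - g *: A (z - l.+1%:Z) v.
Hypotheses (d0 : d 0%N = 1)
  (dS : forall n, n%:R * d n = - g * \sum_(i < n) d i).

(** The identity A(z) H(w) = (1 - w/z)^g H(w) A(z), which reorders the two
    exponentials of a vertex operator.  It follows from the
    differential equation of H and the commutators of A(z) with the creation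
    operators. *)
Lemma normal_order z n v :
  A z (H n v) = \sum_(i < n.+1) d i *: H (n - i)%N (A (z - i%:Z) v).
Proof.
elim/ltn_ind: n z v => -[|n] IHn z v.
  by rewrite big_ord1 d0 scale1r !H0 subr0.
apply: (@scalerI _ _ n.+1%:R); first by rewrite pnatr_eq0.
rewrite -(is_linearZ (A_linear _)) HS (is_linear_sum (A_linear _)).
transitivity
  (\sum_(k < n.+1) \sum_(i < (n - k).+1)
     d i *: cre k (H (n - i - k)%N (A (z - i%:Z) v)) -
   \sum_(i < n.+1) \sum_(k < (n - i).+1)
     (g * d i) *: H (n - (i + k))%N (A (z - (i + k).+1%:Z) v)).
  rewrite -(sum_triangleSC (fun k i =>
    (g * d i) *: H (n - (i + k))%N (A (z - (i + k).+1%:Z) v))) -sumrB.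
  apply: eq_bigr => k _; rewrite A_cre !IHn ?ltnS ?leq_subr //.
  rewrite (is_linear_sum (cre_linear _)) scaler_sumr.
  congr (_ - _); apply: eq_bigr => i _.
    by rewrite (is_linearZ (cre_linear _)) subnAC.
  rewrite scalerA -subnDA [(k + i)%N]addnC.
  by congr (_ *: H _ (A _ _)); lia.
rewrite (sum_triangleSC (fun k i =>
  d i *: cre k (H (n - i - k)%N (A (z - i%:Z) v)))).
rewrite (sum_triangle (fun i k =>
  (g * d i) *: H (n - (i + k))%N (A (z - (i + k).+1%:Z) v))).
have -> : n.+1%:R *: (\sum_(i < n.+2)
      d i *: H (n.+1 - i)%N (A (z - i%:Z) v)) =
    \sum_(i < n.+2) d i *: ((n.+1 - i)%:R *:
      H (n.+1 - i)%N (A (z - i%:Z) v)) +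
    \sum_(i < n.+2) (i%:R * d i) *: H (n.+1 - i)%N (A (z - i%:Z) v).
  rewrite -big_split scaler_sumr; apply: eq_bigr => i _ /=.
  rewrite !scalerA -scalerDl natrB ?leq_ord //; congr (_ *: _).
  by ring.
congr (_ + _).
  rewrite [RHS]big_ord_recr /= subnn scale0r scaler0 addr0.
  apply: eq_bigr => i _; rewrite subSn ?leq_ord // HS scaler_sumr.
  by apply: eq_bigr.
rewrite [RHS]big_ord_recl /= mul0r scale0r add0r -sumrN.
apply: eq_bigr => k _; rewrite /bump leq0n add1n subSS dS.
rewrite mulr_sumr scaler_suml -sumrN; apply: eq_bigr => i _.
by rewrite subnKC ?leq_ord // mulNr scaleNr.
Qed.

End NormalOrder.

Section HeisenbergExp.
Variables (R : realType) (h : vectType R[i]) (g : R[i]).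
Variables (cre ann : nat -> fock h -> fock h).
Hypothesis heisP : heis_pair g cre ann.
Local Notation fock := (fock h).
Implicit Types (v w : fock) (s u : seq nat).

Let cre_linear k : is_linear (cre k) := cre_lin heisP k.
Let ann_linear k : is_linear (ann k) := ann_lin heisP k.

Definition cre_log k v := k.+1%:R^-1 *: cre k v.
Definition ann_log k v := - k.+1%:R^-1 *: ann k v.
(** In terms of the power sums p_k = beta(-k), this is multiplication by the
    complete symmetric function h_n, because exp (sum_k p_k t^k / k) is the
    generating series of the h_n. *)
Definition hsym n : fock -> fock := exp_coef cre_log n.
Definition aexp n : fock -> fock := exp_coef ann_log n.

Lemma cre_log_linear k : is_linear (cre_log k).
Proof. exact/is_linear_scale/cre_linear. Qed.

Lemma ann_log_linear k : is_linear (ann_log k).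
Proof. exact/is_linear_scale/ann_linear. Qed.

Lemma cre_logC k l v : cre_log k (cre_log l v) = cre_log l (cre_log k v).
Proof.
by rewrite /cre_log !(is_linearZ (cre_linear _)) (creC heisP) !scalerA mulrC.
Qed.

Lemma ann_logC k l v : ann_log k (ann_log l v) = ann_log l (ann_log k v).
Proof.
by rewrite /ann_log !(is_linearZ (ann_linear _)) (annC heisP) !scalerA mulrC.
Qed.

Lemma hsym_linear n : is_linear (hsym n).
Proof. exact/exp_coef_linear/cre_log_linear. Qed.

Lemma aexp_linear n : is_linear (aexp n).
Proof. exact/exp_coef_linear/ann_log_linear. Qed.

Lemma hsymS n v :
  n.+1%:R *: hsym n.+1 v = \sum_(k < n.+1) cre k (hsym (n - k)%N v).
Proof.
rewrite [LHS](exp_coef_deriv cre_log_linear cre_logC); apply: eq_bigr => k _.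
by rewrite /cre_log scalerA mulfV ?scale1r // pnatr_eq0.
Qed.

Lemma ann_log_cre k l v :
  cre l (ann_log k v) = ann_log k (cre l v) + ((k == l)%:R * g) *: v.
Proof.
have -> : (k == l)%:R * g = k.+1%:R^-1 * ((k == l)%:R * (k.+1%:R * g)).
  by rewrite [RHS]mulrCA mulKf // pnatr_eq0.
rewrite /ann_log (is_linearZ (cre_linear _)) (ann_cre heisP) !scaleNr scalerDr.
by rewrite opprD scalerA subrK.
Qed.

Lemma cre_aexp l q v :
  cre l (aexp q v) =
  aexp q (cre l v) + (if (l < q)%N then g *: aexp (q - l.+1)%N v else 0).
Proof.
rewrite /aexp (exp_coef_comm ann_log_linear ann_logC q v (cre_linear l)
  (fun k w => ann_log_cre k l w)).
congr (_ + _); case: ifP => [ltlq|/negbT]; last first.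
  rewrite -leqNgt => leql; rewrite big1 // => k _.
  by rewrite (_ : _ == l = false) ?mul0r ?scale0r //; have := ltn_ord k; lia.
rewrite (bigD1 (Ordinal ltlq)) //= eqxx mul1r big1 ?addr0 // => k.
by rewrite -val_eqE /= => /negPf ->; rewrite mul0r scale0r.
Qed.

Lemma ann_cre_log k l v :
  ann k (cre_log l v) = cre_log l (ann k v) + ((l == k)%:R * g) *: v.
Proof.
have -> : (l == k)%:R * g = l.+1%:R^-1 * ((k == l)%:R * (k.+1%:R * g)).
  rewrite eq_sym [RHS]mulrCA; have [->|_] := eqVneq k l; last by rewrite !mul0r.
  by rewrite mulKf // pnatr_eq0.
rewrite /cre_log (is_linearZ (ann_linear _)) (ann_cre heisP) scalerDr.
by rewrite scalerA.
Qed.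

(** beta(N+1) acts as (N+1) g d/dp_(N+1), which takes h_n to
    g h_(n-N-1). *)
Lemma ann_hsym N n v :
  ann N (hsym n v) =
  hsym n (ann N v) + (if (N < n)%N then g *: hsym (n - N.+1)%N v else 0).
Proof.
rewrite /hsym (exp_coef_comm cre_log_linear cre_logC n v (ann_linear N)
  (fun k w => ann_cre_log N k w)).
congr (_ + _); case: ifP => [ltlq|/negbT]; last first.
  rewrite -leqNgt => leql; rewrite big1 // => k _.
  by rewrite (_ : _ == N = false) ?mul0r ?scale0r //; have := ltn_ord k; lia.
rewrite (bigD1 (Ordinal ltlq)) //= eqxx mul1r big1 ?addr0 // => k.
by rewrite -val_eqE /= => /negPf ->; rewrite mul0r scale0r.
Qed.

Definition aexpz (z : int) v := if z is Posz q then aexp q v else 0.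
Definition hsymz (z : int) v := if z is Posz q then hsym q v else 0.

Lemma aexpz_linear z : is_linear (aexpz z).
Proof.
by case: z => n; [exact: aexp_linear | exact: is_linear_cst0].
Qed.

Lemma hsymz_linear z : is_linear (hsymz z).
Proof.
by case: z => n; [exact: hsym_linear | exact: is_linear_cst0].
Qed.

Lemma aexpz_cre l z v :
  aexpz z (cre l v) = cre l (aexpz z v) - g *: aexpz (z - l.+1%:Z) v.
Proof.
case: z => q; last by rewrite /= (is_linear0 (cre_linear _)) scaler0 subrr.
rewrite [aexpz q (cre l v)]/= [aexpz q v]/= cre_aexp.
case: ifP => [ltlq|/negbT]; first by rewrite subzn //= addrK.
rewrite -leqNgt -ltnS => leql; have -> : q%:Z - l.+1%:Z = Negz (l - q) by lia.
by rewrite /= scaler0 subr0 addr0.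
Qed.

Lemma aexpz_hsym z n v :
  aexpz z (hsym n v) =
  \sum_(i < n.+1) geom_coef (- g) i *: hsym (n - i)%N (aexpz (z - i%:Z) v).
Proof.
apply: (normal_order (g := g) (cre := cre)) => //.
- exact: aexpz_linear.
- exact: exp_coef0.
- exact: hsymS.
- exact: aexpz_cre.
- exact: geom_coef0.
by move=> k; apply: binomial_series_partial => i; rewrite geom_coefS.
Qed.

End HeisenbergExp.

(** * Linear independence of the products of complete symmetric functions *)

Lemma mcoeff_reindex (I J : choiceType) (R : nzRingType) (f : I -> J)
    (w : malg I R) x :
    (forall y, mcoeff y w != 0 -> f y = f x -> y = x) ->
  mcoeff (f x) (malg_ext (fun y => mkmalgU (f y) 1) w) = mcoeff x w.
Proof.
move=> fx; rewrite /malg_ext raddf_sum /=.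
under eq_big_seq => y wy.
  rewrite mcoeffZ mcoeffU mulrnAr mulr1 mulrb.
  rewrite (_ : f y == f x = (y == x)); last first.
    by apply/eqP/eqP => [|-> //]; apply: fx; rewrite mcoeff_neq0.
  over.
rewrite -big_mkcond /=; have [xw|xw] := boolP (x \in msupp w).
  by rewrite -big_filter filter_pred1_uniq ?fset_uniq // big_seq1.
rewrite (mcoeff_outdom xw) big1_seq // => y /andP[/eqP ->].
by rewrite (negPf xw).
Qed.

Lemma leq_sumn (s : seq nat) n : n \in s -> (n <= sumn s)%N.
Proof.
elim: s => //= k s IHs; rewrite inE => /predU1P[->|/IHs]; first exact: leq_addr.
by move=> /leq_trans; apply; apply: leq_addl.
Qed.

Lemma seq_bounded (T : eqType) (s : seq T) (F : T -> nat) :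
  exists L, forall x, x \in s -> (F x <= L)%N.
Proof.
by exists (sumn (map F s)) => x sx; apply/leq_sumn/map_f.
Qed.

Section MonomialVectors.
Variables (K : numFieldType) (V : lmodType K) (H : nat -> V -> V).
Hypotheses (H_linear : forall n, is_linear (H n))
  (HC : forall k l v, H k (H l v) = H l (H k v)).
Implicit Types (e v : V) (s u : seq nat).

Definition hvec e s := foldr H e s.

Lemma perm_hvec e s s' : perm_eq s s' -> hvec e s = hvec e s'.
Proof.
apply: (@perm_ind_swap _ (fun s s' => hvec e s = hvec e s')) => //=.
  by move=> s1 s2 s3 ->.
by move=> n s1 s2 _ ->.
Qed.

(** The generating series of A applied to H(w_1) ... H(w_r) e, with all factors
    (1 - w_j / z)^g. *)
Lemma normal_order_hvec (d : nat -> K) (A : int -> V -> V) e z s :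
    (forall z, is_linear (A z)) ->
    (forall z n v, A z (H n v) =
       \sum_(i < n.+1) d i *: H (n - i)%N (A (z - i%:Z) v)) ->
    (forall z, A z e = if z == 0 then e else 0) ->
  A z (hvec e s) =
  shift_sum d (fun t u => if z == t%:Z then hvec e u else 0) s.
Proof.
move=> A_linear AH Ae; elim: s z => [|n s IHs] z /=; first exact: Ae.
rewrite AH; apply: eq_bigr => i _; rewrite IHs.
rewrite (linear_shift_sum _ _ _ (H_linear _)); congr (_ *: _).
apply: eq_shift_sum => t u _ _.
rewrite (_ : (z == (i + t)%N) = (z - i%:Z == t)).
  by case: ifP => // _; rewrite (is_linear0 (H_linear _)).
by apply/eqP/eqP; lia.
Qed.

Section Independence.
Variables (g : K) (a : nat -> V -> V).
Hypothesis g0 : g != 0.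
Hypotheses (a_linear : forall n, is_linear (a n)) (H0 : forall v, H 0%N v = v).
Hypothesis aH : forall N n v, a N (H n v) =
  H n (a N v) + (if (N < n)%N then g *: H (n - N.+1)%N v else 0).

(** On products of h_0, ..., h_(N+1) the operator beta(N+1) acts as
    g d/dh_(N+1): it kills e and h_n for n <= N, and takes h_(N+1) to g. *)
Lemma ann_hvec N e s : a N e = 0 -> all (leq^~ N.+1) s ->
  a N (hvec e s) = (g * (count_mem N.+1 s)%:R) *: hvec e (rem N.+1 s).
Proof.
move=> ae; elim: s => [|n s IHs] /=; first by rewrite mulr0 scale0r.
case/andP=> lenN /IHs {}IHs; rewrite aH IHs (is_linearZ (H_linear _)).
have [->|neqn] := eqVneq n N.+1; last first.
  by rewrite ifF ?addr0 //; apply/negbTE; rewrite -leqNgt -ltnS ltn_neqAle neqn.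
rewrite ltnSn subnn H0 natrD mulrDr mulr1 scalerDl addrC; congr (_ + _).
have [sN|sN] := boolP (N.+1 \in s); last first.
  by rewrite (count_memPn sN) mulr0 !scale0r.
by congr (_ *: _); rewrite [RHS](perm_hvec _ (perm_to_rem sN)).
Qed.

(** Since h_0 = 1, the number of parts, zeros included, is not determined by the
    product of the h_n; it is recorded by the vector e (size S). *)
Definition hcomb (e : nat -> V) : malg {mset nat}%mset K -> V :=
  malg_ext (fun S : {mset nat}%mset => hvec (e (size S)) S).

Lemma hcomb_linear (e : nat -> V) : is_linear (hcomb e).
Proof. exact: malg_ext_linear. Qed.

Lemma perm_madd k (S : {mset nat}%mset) : perm_eq (madd k S) (k :: S).
Proof.
apply/eq_seq_msetP; rewrite mset_cons !seq_mset_id.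
by apply/msetP => n; rewrite maddE mset1DE.
Qed.

Definition parts_le M (w : malg {mset nat}%mset K) :=
  forall S : {mset nat}%mset, mcoeff S w != 0 -> forall n, (M < n)%N -> S n = 0%N.

(** The derivative d/dh_N on formal combinations of products of the h_n. *)
Definition mset_deriv N : malg {mset nat}%mset K -> malg {mset nat}%mset K :=
  malg_ext (fun S : {mset nat}%mset => (S N)%:R *: mkmalgU (mrem N S) 1).

Lemma mcoeff_mset_deriv N w S :
  mcoeff S (mset_deriv N w) = (S N).+1%:R * mcoeff (madd N S) w.
Proof.
rewrite /mset_deriv /malg_ext raddf_sum /=.
under eq_bigr do rewrite !mcoeffZ mcoeffU.
have coefS T : mcoeff T w * ((T N)%:R * (1 *+ (mrem N T == S))) =
    if T == madd N S then (S N).+1%:R * mcoeff (madd N S) w else 0.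
  have [->|neT] := eqVneq T (madd N S).
    by rewrite maddK eqxx mulr1 maddE eqxx mulrC.
  have [TN|TN] := eqVneq (T N) 0%N; first by rewrite TN mul0r mulr0.
  have [eqT|_] := eqVneq (mrem N T) S; last by rewrite !mulr0.
  by rewrite -eqT mremK ?eqxx in neT.
under eq_bigr do rewrite coefS.
rewrite -big_mkcond /=; have [Sw|Sw] := boolP (madd N S \in msupp w).
  by rewrite -big_filter filter_pred1_uniq ?fset_uniq // big_seq1.
by rewrite (mcoeff_outdom Sw) mulr0 big1.
Qed.

Lemma ann_hcomb N (e : nat -> V) w :
    (forall r, a N (e r) = 0) -> parts_le N.+1 w ->
  a N (hcomb e w) = g *: hcomb (fun r => e r.+1) (mset_deriv N.+1 w).
Proof.
move=> ae wN; rewrite {1}/hcomb {1}/malg_ext (is_linear_sum (a_linear _)).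
rewrite /mset_deriv /malg_ext (is_linear_sum (hcomb_linear _)).
rewrite scaler_sumr; apply: eq_big_seq => S wS.
rewrite (is_linearZ (a_linear _)) !(is_linearZ (hcomb_linear _)).
rewrite /hcomb malg_extU ann_hvec //; last first.
  apply/allP => n Sn; rewrite leqNgt; apply: contraL Sn => /(wN S).
  by rewrite mcoeff_neq0 => /(_ wS); rewrite -mset_eq0 => ->.
rewrite count_mem_mset.
have [SN|SN] := eqVneq (S N.+1) 0%N.
  by rewrite SN mulr0 !scale0r !scaler0.
have Sperm : perm_eq (S : {mset nat}%mset) (N.+1 :: mrem N.+1 S).
  by rewrite -{1}(mremK SN) perm_madd.
rewrite (perm_size Sperm) /= (@perm_hvec _ _ (mrem N.+1 S)).
  by rewrite !scalerA mulrCA.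
rewrite -(perm_cons N.+1) perm_sym (perm_trans _ (perm_to_rem _)) //.
  by rewrite perm_sym.
by rewrite -mset_neq0.
Qed.

Definition free_family (e : nat -> V) :=
  forall w : malg nat K, malg_ext e w = 0 -> w = 0.

(** A derivative removes a part, so it shifts the family by one. *)
Lemma free_familyS (e : nat -> V) : free_family e -> free_family (fun r => e r.+1).
Proof.
move=> efree w ew; pose w' := malg_ext (fun r => mkmalgU r.+1 (1 : K)) w.
suff w'0 : w' = 0.
  apply/malgP => r; rewrite -(mcoeff_reindex (f := S)) => [|y _ [] //].
  by rewrite -/w' w'0 !mcoeff0.
apply: efree.
rewrite /w' {2}/malg_ext (is_linear_sum (malg_ext_linear _)) -[RHS]ew.
rewrite [RHS]/malg_ext; apply: eq_bigr => r _.
by rewrite (is_linearZ (malg_ext_linear _)) malg_extU.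
Qed.

(** By induction on the largest part M and on its multiplicity: beta(M+1)
    differentiates a relation in h_(M+1), and the derivative is a relation with
    smaller multiplicities, so h_(M+1) does not occur.  For M = 0 there are only
    powers of h_0 = 1, which the freeness of e separates. *)
Lemma hcomb_inj_parts M (e : nat -> V) w :
    (forall N r, a N (e r) = 0) -> free_family e -> parts_le M w ->
  hcomb e w = 0 -> w = 0.
Proof.
elim: M e w => [|M IHM] e w ae efree.
  move=> w0 hw0; pose w' := malg_ext (fun S : {mset nat}%mset =>
    mkmalgU (size S) (1 : K)) w.
  have supp0 (S : {mset nat}%mset) :
      mcoeff S w != 0 -> perm_eq S (nseq (size S) 0%N).
    move=> wS; have /all_pred1P Sall : all (pred1 0%N) S.
      apply/allP => -[//|n] Sn.
      by have /eqP := w0 S wS n.+1 isT; rewrite mset_eq0 Sn.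
    by rewrite {1}Sall.
  have w'0 : w' = 0.
    apply: efree; rewrite /w' {2}/malg_ext (is_linear_sum (malg_ext_linear _)).
    rewrite -[RHS]hw0 [RHS]/hcomb [RHS]/malg_ext; apply: eq_big_seq.
    move=> /= S Sw.
    rewrite (is_linearZ (malg_ext_linear _)) malg_extU; congr (_ *: _).
    have S0 : mcoeff S w != 0 by rewrite mcoeff_neq0.
    have hvec0 n v : hvec v (nseq n 0%N) = v by elim: n => //= n ->.
    by rewrite (perm_hvec _ (supp0 _ S0)) hvec0.
  apply/malgP => /= S; rewrite mcoeff0; apply/eqP/negPn/negP => wS.
  have := wS; rewrite -(mcoeff_reindex (f := fun S : {mset nat}%mset => size S)).
    by rewrite -/w' w'0 mcoeff0 eqxx.
  move=> T wT eqsz; rewrite -(seq_mset_id T) -(seq_mset_id S); apply/eq_seq_msetP.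
  by rewrite (permPl (supp0 _ wT)) eqsz perm_sym supp0.
move=> wM.
have [L wL] := seq_bounded (msupp w) (fun S : {mset nat}%mset => S M.+1).
have {}wL S : mcoeff S w != 0 -> (S M.+1 <= L)%N.
  by rewrite mcoeff_neq0 => /wL.
elim: L => [|L IHL] in e w ae efree wM wL *.
  apply: IHM => // S wS n; rewrite leq_eqVlt => /predU1P[<-|]; last exact: wM.
  by apply/eqP; rewrite -leqn0; apply: wL.
move=> hw0; have w'0 : mset_deriv M.+1 w = 0.
  apply: (IHL (fun r => e r.+1)); rewrite ?mulr0 //.
  - exact: free_familyS.
  - move=> S; rewrite mcoeff_mset_deriv mulf_eq0 negb_or => /andP[_ /wM Sn] n.
    by move=> /Sn; rewrite maddE => /eqP; rewrite addn_eq0 => /andP[_ /eqP].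
  - move=> S; rewrite mcoeff_mset_deriv mulf_eq0 negb_or => /andP[_ /wL].
    by rewrite maddE eqxx.
  apply: (scalerI g0); rewrite -ann_hcomb // hw0 scaler0.
  by rewrite (is_linear0 (a_linear _)).
apply: IHM (hw0) => // S wS n; rewrite leq_eqVlt => /predU1P[<-|]; last exact: wM.
apply/eqP/negPn/negP => SM; case/negP: wS.
have /eqP := mcoeff_mset_deriv M.+1 w (mrem M.+1 S).
by rewrite w'0 mcoeff0 mremK // eq_sym mulf_eq0 pnatr_eq0.
Qed.

Lemma hcomb_inj (e : nat -> V) w :
  (forall N r, a N (e r) = 0) -> free_family e -> hcomb e w = 0 -> w = 0.
Proof.
move=> ae efree.
have [L wL] := seq_bounded (msupp w) (fun S : {mset nat}%mset => sumn S).
apply: (@hcomb_inj_parts L) => // S; rewrite mcoeff_neq0 => /wL LS n ltLn.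
apply/eqP; rewrite mset_eq0; apply: contraL ltLn => Sn; rewrite -leqNgt.
by apply: leq_trans LS; apply: leq_sumn.
Qed.

End Independence.
End MonomialVectors.

(** * The vertex operator on the Fock space *)

Lemma sum_pick (K : pzRingType) (V : lmodType K) (f : nat -> V -> V) t N x :
    (forall q, f q 0 = 0) -> (t < N)%N ->
  \sum_(q < N) 1 *: f q (if q%:Z == t%:Z :> int then x else 0) = f t x.
Proof.
move=> f0 ltN; rewrite (bigD1 (Ordinal ltN)) //= eqxx scale1r big1 ?addr0 //.
move=> q neq; rewrite ifF ?f0 ?scaler0 //; apply/negbTE.
by apply: contraNneq neq => -[eqt]; apply/eqP/val_inj.
Qed.

Lemma fsum_diagonal (V : zmodType) (F : nat -> nat -> V) (A : set (nat * nat))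
    (k : int) N :
    (forall p q, A (p, q) <-> p%:Z = k + q%:Z) ->
    (forall p q, (N <= q)%N -> F p q = 0) ->
  \sum_(pq \in A) F pq.1 pq.2 =
  \sum_(q < N) (if k + q%:Z is Posz p then F p q else 0).
Proof.
move=> AP F0.
pose r := [seq (absz (k + q%:Z), q) | q <- iota 0 N & 0 <= k + q%:Z].
have rP p q : ((p, q) \in r) = (p%:Z == k + q%:Z) && (q < N)%N.
  apply/mapP/andP => [[q']|[/eqP pq ltqN]].
    rewrite mem_filter mem_iota => /andP[kq ltq] [-> ->].
    by split=> //; rewrite gez0_abs.
  exists q; last by rewrite -pq.
  by rewrite mem_filter -pq mem_iota.
rewrite (fsbigE r); first last.
- move=> [p q] /AP /= pq; rewrite rP pq eqxx /= -leqNgt; exact: F0.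
- by move=> [p q]; rewrite /= rP => /andP[/eqP /AP].
- by rewrite map_inj_uniq ?filter_uniq ?iota_uniq // => q q' [].
rewrite big_map big_filter_cond -(big_mkord xpredT
  (fun q => if k + q%:Z is Posz p then F p q else 0)) /index_iota subn0.
rewrite [RHS](bigID (fun q : nat => 0 <= k + q%:Z)) /= [X in _ + X]big1 ?addr0.
  apply: eq_big => [q|q /andP[kq _]] /=; last by case: (k + q%:Z) kq.
  case kq: (0 <= k + q%:Z) => //=; rewrite ?andbT; apply/mem_set/AP.
  by rewrite gez0_abs.
by move=> q; case: (k + q%:Z).
Qed.

Section HeisenbergVacuum.
Variables (R : realType) (h : vectType R[i]) (g : R[i]).
Variables (cre ann : nat -> fock h -> fock h) (e : fock h).
Hypothesis heisP : heis_pair g cre ann.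
Hypothesis ann_e : forall k, ann k e = 0.
Local Notation hsym := (hsym cre).
Local Notation aexp := (aexp ann).
Local Notation hsymz := (hsymz cre).
Local Notation aexpz := (aexpz ann).

Lemma hsym0 v : hsym 0 v = v.
Proof. exact: exp_coef0. Qed.

Lemma hsymC k l v : hsym k (hsym l v) = hsym l (hsym k v).
Proof.
have lin := cre_log_linear heisP; have comm := cre_logC heisP.
apply: (exp_coef_commute lin comm) => [|j w]; first exact: exp_coef_linear.
by apply/esym; apply: (exp_coef_commute lin comm).
Qed.

Lemma aexp_vac q : aexp q e = if q == 0%N then e else 0.
Proof.
elim/ltn_ind: q => -[|q] IHq; first exact: exp_coef0.
apply: (@scalerI _ _ q.+1%:R); first by rewrite pnatr_eq0.
rewrite scaler0 [LHS](exp_coef_deriv (ann_log_linear heisP) (ann_logC heisP)).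
rewrite big1 // => k _; rewrite -/(aexp (q - k)%N e) IHq ?ltnS ?leq_subr //.
have lin := ann_log_linear heisP.
by case: ifP => _; rewrite ?(is_linear0 (lin _)) ?[ann_log _ _ _]scalerN /ann_log
  ?ann_e !scaler0.
Qed.

Lemma aexpz_vac z : aexpz z e = if z == 0 then e else 0.
Proof. by case: z => // q; rewrite [LHS]aexp_vac. Qed.

Lemma aexp_creation q (s : seq nat) : (sumn (map succn s) < q)%N ->
  aexp q (foldr cre e s) = 0.
Proof.
elim: s q => [|l s IHs] q /= ltq; first by rewrite aexp_vac ifF //; lia.
have := cre_aexp heisP l q (foldr cre e s).
rewrite IHs ?(is_linear0 (cre_lin heisP _)); last by lia.
case: ifP => [ltlq|_]; last by rewrite addr0 => <-.
by rewrite IHs ?scaler0 ?addr0 => [<-|] //; lia.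
Qed.

End HeisenbergVacuum.

Section FockSpace.
Variables (R : realType) (h : vectType R[i]) (form : h -> h -> R[i]).
Variable beta : h.
Hypothesis hform : is_form form.
Hypothesis hbeta : form beta beta != 0.
Local Notation fock := (fock h).
Local Notation g := (form beta beta).
Implicit Types (v w : fock) (ga : h) (S : {mset nat}%mset) (s u : seq nat).

Definition cre k : fock -> fock := heis form beta beta (- k.+1%:Z).
Definition ann k : fock -> fock := heis form beta beta k.+1%:Z.

Lemma linear_fock_ext (f f' : fock -> fock) : is_linear f -> is_linear f' ->
    (forall ga S, f (fock_basis (ga, S)) = f' (fock_basis (ga, S))) ->
  f =1 f'.
Proof.
by move=> lf lf' eqf; apply: (linear_malg_ext lf lf') => -[ga S]; apply: eqf.
Qed.

Lemma fock_ext_linear f : is_linear (fock_ext f : fock -> fock).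
Proof. exact: malg_ext_linear. Qed.

Lemma fock_ext_basis f x : fock_ext f (fock_basis x : fock) = f x.
Proof. exact: malg_extU. Qed.

Lemma cre_basis k ga S : cre k (fock_basis (ga, S)) = fock_basis (ga, madd k S).
Proof. by rewrite /cre /heis fock_ext_basis /= divff // scale1r /madd -lock. Qed.

Lemma ann_basis k ga S :
  ann k (fock_basis (ga, S)) =
  (k.+1%:R * g * (S k)%:R) *: fock_basis (ga, mrem k S).
Proof. by rewrite /ann /heis fock_ext_basis /mrem -lock. Qed.

Lemma fock_heis_pair : heis_pair g cre ann.
Proof.
apply: (@polynomial_heis_pair _ h _ (fun ga S => fock_basis (ga, S))).
- exact: linear_fock_ext.
- by move=> k; apply: fock_ext_linear.
- by move=> k; apply: fock_ext_linear.
- exact: cre_basis.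
- exact: ann_basis.
Qed.

Local Notation hsym := (hsym cre).
Local Notation aexp := (aexp ann).
Local Notation hsymz := (hsymz cre).
Local Notation aexpz := (aexpz ann).
Local Notation shift := (fock_shift beta).

Lemma ann_fock_exp k ga : ann k (fock_exp ga) = 0.
Proof. by rewrite /fock_exp ann_basis mset0E mulr0 scale0r. Qed.

Lemma fock_basis_creation ga s :
  foldr cre (fock_exp ga) s = fock_basis (ga, seq_mset s).
Proof.
elim: s => [|k s IHs] /=.
  by rewrite -[X in seq_mset X]enum_mset0 seq_mset_id.
have -> : seq_mset (k :: s) = madd k (seq_mset s).
  by rewrite /madd -lock; apply: mset_cons.
by rewrite IHs; apply: cre_basis.
Qed.

(** The sum that defines [vertex_exp] has finitely many nonzero terms. *)
Lemma aexp_fock_basis ga S :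
  exists N, forall q, (N <= q)%N -> aexp q (fock_basis (ga, S)) = 0.
Proof.
exists (sumn (map succn S)).+1 => q ltq.
have -> : fock_basis (ga, S) = foldr cre (fock_exp ga) S.
  by rewrite fock_basis_creation seq_mset_id.
exact: (aexp_creation fock_heis_pair (ann_fock_exp^~ ga) ltq).
Qed.

Lemma shift_basis ga S : shift (fock_basis (ga, S)) = fock_basis (beta + ga, S).
Proof. exact: fock_ext_basis. Qed.

Lemma shift_linear : is_linear shift.
Proof. exact: malg_ext_linear. Qed.

Lemma shift_cre k w : shift (cre k w) = cre k (shift w).
Proof.
move: w; apply: linear_fock_ext => [||ga S].
- by apply: is_linear_comp; exact: fock_ext_linear.
- by apply: is_linear_comp; exact: fock_ext_linear.
(* Rewriting would compare basis vectors by computation. *)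
apply: (etrans (congr1 shift (cre_basis k ga S))).
apply: (etrans (shift_basis ga (madd k S))); apply/esym.
by apply: (etrans (congr1 (cre k) (shift_basis ga S))); apply: cre_basis.
Qed.

Lemma shift_hsym n v : shift (hsym n v) = hsym n (shift v).
Proof.
apply: (exp_coef_commute (cre_log_linear fock_heis_pair)
  (cre_logC fock_heis_pair)) => [|k w]; first exact: shift_linear.
apply: (etrans (is_linearZ shift_linear k.+1%:R^-1 (cre k w))).
exact (congr1 ( *:%R k.+1%:R^-1) (shift_cre k w)).
Qed.

Lemma shift_hvec ga s :
  shift (hvec hsym (fock_exp ga) s) = hvec hsym (fock_exp (beta + ga)) s.
Proof.
elim: s => [|n s IHs] /=; first by rewrite /fock_exp shift_basis.
by rewrite shift_hsym IHs.
Qed.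

Lemma fock_degP ga v :
  fock_deg ga v <-> forall x, x.1 != ga -> mcoeff x v = 0.
Proof.
split=> [degv x|degv x].
  by move=> nex; apply: mcoeff_outdom; apply: contra nex => /degv ->.
by rewrite -mcoeff_neq0 => vx; apply/eqP; apply: contraNT vx => /degv ->.
Qed.

Lemma fock_deg_subspace ga : subspace (@fock_deg R h ga).
Proof.
split=> [|a u w /fock_degP du /fock_degP dw]; apply/fock_degP => x nex.
  by rewrite mcoeff0.
by rewrite mcoeffD mcoeffZ du // dw // mulr0 addr0.
Qed.

Lemma fock_deg_basis ga S : fock_deg ga (fock_basis (ga, S) : fock).
Proof.
apply/fock_degP => x nex; rewrite /fock_basis mcoeffU.
by have [E|//] := eqVneq (ga, S) x; rewrite -E eqxx in nex.
Qed.

Lemma hvec_deg ga s : fock_deg ga (hvec hsym (fock_exp ga) s).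
Proof.
have sub := fock_deg_subspace ga.
elim: s => [|n s IHs] /=; first exact: fock_deg_basis.
apply: (@subspace_exp_coef R h (cre_log cre) (@fock_deg R h ga)) => // k w degw.
apply: (subspaceZ sub).
rewrite (linear_malgE w (fock_ext_linear _ : is_linear (cre k))).
apply: (subspace_sum sub) => -[ga' S] xw; apply: (subspaceZ sub).
have /= -> := degw _ xw.
by move: (cre_basis k ga S); rewrite /fock_basis => ->; apply: fock_deg_basis.
Qed.

Lemma vertex_exp_basis (k : int) ga S N :
    (forall q, (N <= q)%N -> aexp q (shift (fock_basis (ga, S))) = 0) ->
  vertex_exp form beta beta (- k%:~R - 1 - form beta ga) (fock_basis (ga, S)) =
  \sum_(q < N) hsymz (k + q%:Z) (aexp q (shift (fock_basis (ga, S)))).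
Proof.
move=> w0; rewrite /vertex_exp fock_ext_basis.
rewrite (@fsum_diagonal _ (fun p q => hsym p (aexp q (shift (fock_basis (ga, S)))))
  _ k N) => [|p q|p q leNq].
- by apply: eq_bigr => q _; case: (k + q%:Z).
- have castE n : (n%:Z)%:~R = n%:R :> R[i] by [].
  split=> /= pq; last first.
    have -> : p%:R = k%:~R + q%:R :> R[i] by rewrite -!castE -rmorphD /= -pq.
    by ring.
  apply: (@intr_inj R[i]); rewrite rmorphD /= !castE.
  have -> : p%:R = (p%:R - q%:R + form beta ga) + q%:R - form beta ga by ring.
  by rewrite pq; ring.
- by rewrite w0 // (is_linear0 (hsym_linear fock_heis_pair _)).
Qed.

Lemma vertex_exp_deg ga v : fock_deg ga v ->
  exists N0, forall N, (N0 <= N)%N -> forall k : int,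
  vertex_exp form beta beta (- k%:~R - 1 - form beta ga) v =
  \sum_(q < N) hsymz (k + q%:Z) (aexp q (shift v)).
Proof.
move=> degv; have [N0 HN0] : exists N0, forall x, x \in msupp v ->
    forall q, (N0 <= q)%N -> aexp q (shift (fock_basis x)) = 0.
  have /choice[N HN] (x : fock_index h) : exists N, forall q, (N <= q)%N ->
      aexp q (shift (fock_basis x)) = 0.
    case: x => ga' S; have [N HN] := aexp_fock_basis (beta + ga') S.
    exists N => q /HN aq; apply: etrans aq; congr (aexp q _).
    exact: shift_basis.
  have [N0 HN0] := seq_bounded (msupp v) N.
  by exists N0 => x /HN0 leN q leN0; apply: HN; apply: leq_trans leN0.
exists N0 => N leN k.
pose G (w : fock) := \sum_(q < N) hsymz (k + q%:Z) (aexp q (shift w)).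
have Glin : is_linear G.
  apply: is_linear_bigsum => q.
  apply: (is_linear_comp (hsymz_linear fock_heis_pair _)).
  exact: (is_linear_comp (aexp_linear fock_heis_pair _) shift_linear).
rewrite -/(G v) (linear_malgE v Glin).
rewrite (linear_malgE v (fock_ext_linear _ :
  is_linear (vertex_exp form beta beta (- k%:~R - 1 - form beta ga)))).
apply: eq_big_seq => -[ga' S] vx; congr (_ *: _).
have /= eqga := degv _ vx; rewrite -eqga; apply: vertex_exp_basis => q leNq.
exact: (HN0 _ vx _ (leq_trans leN leNq)).
Qed.

(** The annihilating exponential is moved past all the H(w_j) and disappears on
    the vacuum vector; it leaves the factors (1 - w_j / z)^g. *)
Lemma vertex_exp_hvec (k : int) ga s :
  vertex_exp form beta beta (- k%:~R - 1 - form beta ga)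
    (hvec hsym (fock_exp ga) s) =
  shift_sum (geom_coef (- g))
    (fun t u => hsymz (k + t%:Z) (hvec hsym (fock_exp (beta + ga)) u)) s.
Proof.
have [N0 HN0] := vertex_exp_deg (@hvec_deg ga s).
pose N := (maxn N0 (sumn s).+1).
rewrite (HN0 N) ?leq_maxl // shift_hvec.
have aexpE q : aexp q (hvec hsym (fock_exp (beta + ga)) s) =
    shift_sum (geom_coef (- g)) (fun t u => if q%:Z == t%:Z :> int then
      hvec hsym (fock_exp (beta + ga)) u else 0) s.
  apply: (normal_order_hvec (A := aexpz) _ (q%:Z)).
  - by move=> n; apply: hsym_linear fock_heis_pair _.
  - by move=> z; apply: aexpz_linear fock_heis_pair _.
  - exact: aexpz_hsym fock_heis_pair.
  - by apply: aexpz_vac fock_heis_pair _ => j; apply: ann_fock_exp.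
under eq_bigr => q _.
  rewrite aexpE (linear_shift_sum _ _ _ (hsymz_linear fock_heis_pair _)).
  rewrite -[shift_sum _ _ _]scale1r; over.
rewrite -(shift_sum_sum _ _ (fun=> 1) (fun q t u => hsymz (k + q%:Z)
  (if q%:Z == t%:Z :> int then hvec hsym (fock_exp (beta + ga)) u else 0))).
apply: eq_shift_sum => t u szu sumu.
have ltN : (t < N)%N by rewrite /N leq_max; apply/orP; right; lia.
apply: (sum_pick (f := fun q => hsymz (k + q%:Z))) ltN => q.
exact: (is_linear0 (hsymz_linear fock_heis_pair _)).
Qed.

(** The products of complete symmetric functions satisfy the recursion of
    [sym_vec] for the modes of the vertex operator: the factors
    (1 - w_j / z)^(- g) in that recursion cancel those of the vertex operator. *)
Lemma hvec_cons_vertex (n : nat) ga s :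
  hvec hsym (fock_exp (beta + ga)) (n :: s) =
  shift_sum (geom_coef g) (fun t u =>
    vertex_exp form beta beta (- (n%:Z + t%:Z)%:~R - 1 - form beta ga)
      (hvec hsym (fock_exp ga) u)) s.
Proof.
have inv := @geom_coef_inv R g.
transitivity (hsymz (n%:Z + 0%:Z) (hvec hsym (fock_exp (beta + ga)) s)).
  by rewrite addr0.
apply: (etrans (esym (shift_sum_inv (fun t u => hsymz (n%:Z + t%:Z)
  (hvec hsym (fock_exp (beta + ga)) u)) s inv))).
apply: eq_shift_sum => t u _ _; rewrite vertex_exp_hvec.
by apply: eq_shift_sum => t' u' _ _; rewrite PoszD addrA.
Qed.

End FockSpace.

(** * The module generated by a highest weight vector *)

Lemma classZ_eq (R : realType) (x y : R[i]) :
  classZ x = classZ y -> exists k : int, x = y + k%:~R.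
Proof.
move=> /eqP; rewrite /classZ -Quotient.idealrBE => /asboolW[k xy].
by exists k; rewrite -xy addrC subrK.
Qed.

Lemma cexpN (R : realType) (z : R[i]) : cexp z * cexp (- z) = 1.
Proof.
case: z => x y; rewrite /cexp /= mulrACA -rmorphM /= -expRD subrr expR0.
rewrite cosN sinN mul1r; apply/eqP; rewrite eq_complex /= !mulrN opprK -!expr2.
by rewrite cos2Dsin2 eqxx /= mulrC addNr.
Qed.

Lemma expipiN (R : realType) (z : R[i]) : expipi z * expipi (- z) = 1.
Proof. by rewrite /expipi mulrN cexpN. Qed.

Lemma fsum_ord (V : zmodType) (F : nat -> V) N :
  (forall i, (N <= i)%N -> F i = 0) ->
  \sum_(i \in [set: nat]) F i = \sum_(i < N) F i.
Proof.
move=> F0; rewrite (fsbigE (iota 0 N)) ?iota_uniq //.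
  rewrite -(big_mkord xpredT F) /index_iota subn0.
  by apply: eq_bigl => i; rewrite in_setT.
by move=> i _; rewrite mem_iota add0n -leqNgt; apply: F0.
Qed.

Lemma subspace_fsum (K : pzRingType) (V : lmodType K) (P : set V)
    (I : choiceType) (A : set I) (F : I -> V) :
  subspace P -> (forall i, P (F i)) -> P (\sum_(i \in A) F i).
Proof. by move=> Psub PF; apply: (subspace_sum Psub). Qed.

Section FreeModule.
Variables (R : realType) (g m : R[i]) (F : gva R int) (b : F).
Variables (M : gmod F int) (v : M).
Hypotheses (hF : in_G g b) (hM : in_Mod g m b v).
Let Fgva := in_G_gva hF.
Let Mmod := in_Mod_gmod hM.

(** Applied to the vacuum, one side of locality has no negative powers of w and
    the other no negative powers of z.  The coefficients of w^0 then say that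
    (z - 0)^(- g) Y(b, z) b has no negative powers of z. *)
Lemma gva_mode_gen (j : nat) : gva_mode F b (- g + j%:R) b = 0.
Proof.
have vacE n : ~ (exists k : nat, n = - k.+1%:R) ->
    gva_mode F b n (gva_vac F) = 0 by apply: (gva_creation Fgva b).2.
have nat0 n : gva_mode F b n%:R (gva_vac F) = 0.
  apply: vacE => -[k] /eqP; rewrite -subr_eq0 opprK -natrD pnatr_eq0.
  by rewrite addnS.
have mlin u n := gva_mode_linr Fgva u n.
have := in_G_locality hF (gva_vac F) j%:R (-1).
rewrite /mul_zw /mul_wz [RHS]fsbig1 => [|i _]; last first.
  by rewrite -natrD nat0 (is_linear0 (mlin _ _)) scaler0.
rewrite (@fsum_ord _ _ 1) => [|[|i] // _]; last first.
  have -> : -1 + i.+1%:R = i%:R :> R[i] by rewrite -natr1; ring.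
  by rewrite nat0 (is_linear0 (mlin _ _)) scaler0.
rewrite big_ord1 expr0 mul1r subr0 addr0 (gva_creation Fgva b).1.
by rewrite /cbinom big_ord0 fact0 divr1 scale1r addrC.
Qed.

(** The coefficient of z^(k + m + g r) in Y(b, z) on vectors of degree r, the
    only powers of z that occur there. *)
Definition bmode r (k : int) : M -> M :=
  gmod_mode M b (- k%:~R - 1 - (m + g * r%:R)).

Definition mod_deg (r : nat) : set M := gmod_deg M r%:Z.

Lemma mod_deg_subspace r : subspace (mod_deg r).
Proof. by have [deg _ _] := gmod_grading Mmod; apply: deg. Qed.

Lemma bmode_linear r k : is_linear (bmode r k).
Proof. exact: (gmod_mode_linr Mmod). Qed.

Lemma bmode_deg r k x : mod_deg r x -> mod_deg r.+1 (bmode r k x).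
Proof.
by move=> rx; have [deg _ _] := gmod_series Mmod (in_G_deg hF) rx; apply: deg.
Qed.

Lemma bmode_vac k : k < 0 -> bmode 0 k v = 0.
Proof.
case: k => // k _; rewrite /bmode NegzE mulr0 addr0.
have -> : - (- k.+1%:Z)%:~R - 1 - m = - m + k%:R :> R[i].
  by rewrite rmorphN /= opprK -pmulrn -natr1; ring.
apply: (in_Mod_ann hM) => -[j] /eqP; rewrite -subr_eq0 opprK -natrD pnatr_eq0.
by rewrite addnS.
Qed.

(** The Borcherds identity for n = - g, whose right-hand side vanishes by
    [gva_mode_gen] and whose phase is 1.  Dividing by suitable powers of z and w
    turns (z - w)^(- g) into (1 - w/z)^(- g). *)
Lemma bmode_loc r x k l N : mod_deg r x ->
    (forall i, (N <= i)%N ->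
       bmode r (k - i%:Z) x = 0 /\ bmode r (l - i%:Z) x = 0) ->
  \sum_(i < N) geom_coef g i *: bmode r.+1 (k + i%:Z) (bmode r (l - i%:Z) x) =
  \sum_(i < N) geom_coef g i *: bmode r.+1 (l + i%:Z) (bmode r (k - i%:Z) x).
Proof.
move=> rx x0; pose p := - k%:~R - 1 - (m + g * r%:R).
pose q := - l%:~R - 1 - (m + g * r%:R).
have Dg : classZ (- g) = free_Delta g 1 1.
  by rewrite /free_Delta !mulr1z !mulr1.
have := gmod_borcherds Mmod (in_G_deg hF) (in_G_deg hF) rx Dg p q.
rewrite [RHS](_ : _ = 0); last first.
  rewrite /delta_sum; case: ifP => // _; rewrite fsbig1 // => j _.
  by rewrite gva_mode_gen (is_linear0 (gmod_mode_linl Mmod _ _)) scaler0.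
have -> : free_phase g 1 1 * expipi (- g) = 1.
  by rewrite /free_phase !mulr1z !mulr1 expipiN.
rewrite scale1r => /subr0_eq.
have idx i j (a c : int) : (- a%:~R - 1 - (m + g * i%:R) : R[i]) - g - j%:R =
    - (a + j%:Z)%:~R - 1 - (m + g * i.+1%:R).
  by rewrite rmorphD /= -natr1 -pmulrn; ring.
have idx' i j (a c : int) : (- a%:~R - 1 - (m + g * i%:R) : R[i]) + j%:R =
    - (a - j%:Z)%:~R - 1 - (m + g * i%:R).
  by rewrite rmorphB /= -pmulrn; ring.
rewrite /mul_zw /mul_wz (@fsum_ord _ _ N) => [|i leNi]; last first.
  rewrite (idx' _ _ l l) -/(bmode r (l - i%:Z) x) (x0 _ leNi).2.
  by rewrite (is_linear0 (gmod_mode_linr Mmod _ _)) scaler0.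
rewrite (@fsum_ord _ _ N) => [|i leNi]; last first.
  rewrite (idx' _ _ k k) -/(bmode r (k - i%:Z) x) (x0 _ leNi).1.
  by rewrite (is_linear0 (gmod_mode_linr Mmod _ _)) scaler0.
move=> eqzw; transitivity (\sum_(i < N) ((-1) ^+ i * cbinom (- g) i) *:
  gmod_mode M b (p - g - i%:R) (gmod_mode M b (q + i%:R) x)).
  by apply: eq_bigr => i _; rewrite (idx' _ _ l l) (idx _ _ k k).
rewrite eqzw; apply: eq_bigr => i _.
by rewrite (idx' _ _ k k) (idx _ _ l l).
Qed.

Definition modvec := sym_vec (geom_coef g) bmode v.

Lemma modvec_deg s : mod_deg (size s) (modvec s).
Proof.
apply: sym_vec_deg; [exact: mod_deg_subspace | exact: in_Mod_deg hM |].
exact: bmode_deg.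
Qed.

Let dc n : \sum_(i < n.+1) geom_coef (- g) i * geom_coef g (n - i)%N =
  (n == 0%N)%:R.
Proof. by rewrite -(geom_coef_inv (- g)) opprK. Qed.

Lemma perm_modvec s s' : perm_eq s s' -> modvec s = modvec s'.
Proof.
apply: (perm_sym_vec dc mod_deg_subspace (in_Mod_deg hM) bmode_deg bmode_linear
  bmode_vac bmode_loc).
Qed.

Definition modcomb : malg {mset nat}%mset R[i] -> M :=
  malg_ext (fun S : {mset nat}%mset => modvec S).

Definition modspan : set M := [set x | exists w, x = modcomb w].

Lemma modspan_subspace : subspace modspan.
Proof.
have lin : is_linear modcomb := malg_ext_linear _.
split=> [|a x y [wx ->] [wy ->]]; first by exists 0; rewrite (is_linear0 lin).
by exists (a *: wx + wy); rewrite lin.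
Qed.

Lemma modspan_vec s : modspan (modvec s).
Proof.
exists (mkmalgU (seq_mset s) 1); rewrite /modcomb malg_extU.
by apply: perm_modvec; rewrite perm_sym perm_eq_seq_mset.
Qed.

Definition preserves_modspan (u : F) :=
  forall n x, modspan x -> modspan (gmod_mode M u n x).

Lemma preserves_modspanP u :
    (forall n s, modspan (gmod_mode M u n (modvec s))) -> preserves_modspan u.
Proof.
move=> uX n _ [w ->]; rewrite /modcomb /malg_ext.
rewrite (is_linear_sum (gmod_mode_linr Mmod _ _)).
apply: (subspace_sum modspan_subspace) => S _.
rewrite (is_linearZ (gmod_mode_linr Mmod _ _)).
exact/(subspaceZ modspan_subspace)/uX.
Qed.

Lemma preserves_modspan_subspace : subspace preserves_modspan.
Proof.
split=> [n x _|a u w pu pw n x xT].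
  rewrite (is_linear0 (gmod_mode_linl Mmod _ _)).
  exact: subspace0 modspan_subspace.
rewrite (gmod_mode_linl Mmod); apply: modspan_subspace.2; [exact: pu | exact: pw].
Qed.

Lemma preserves_modspan_gen : preserves_modspan b.
Proof.
apply: preserves_modspanP => n s.
have [_ b0 _] := gmod_series Mmod (in_G_deg hF) (modvec_deg s).
have [nD|/b0 ->] := pselect (classZ n = free_Delta1 g m 1 (size s)); last first.
  exact: subspace0 modspan_subspace.
have [k ->] := classZ_eq nD.
have -> : - (m * 1%:~R) - g * 1%:~R * (size s)%:~R + k%:~R =
    - (- k - 1)%:~R - 1 - (m + g * (size s)%:R) :> R[i].
  by rewrite rmorphB rmorphN /= !mulr1z -pmulrn; ring.
apply: (mode_sym_vec_closed dc mod_deg_subspace (in_Mod_deg hM) bmode_deg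
  bmode_linear bmode_vac bmode_loc); first exact: modspan_subspace.
exact: modspan_vec.
Qed.

Lemma preserves_modspan_vac : preserves_modspan (gva_vac F).
Proof.
move=> n x xT; rewrite (gmod_vac_id Mmod); case: ifP => // _.
exact: subspace0 modspan_subspace.
Qed.

(** In the Borcherds identity the modes of u(n) w are the term j = 0 on the
    right, and u(n+j) w = 0 for large j: descending induction on n expresses
    them by modes of u, of w, and of the u(n+j) w with j > 0. *)
Lemma preserves_modspan_mode r s (u w : F) n :
    gva_deg F r u -> gva_deg F s w ->
    preserves_modspan u -> preserves_modspan w ->
  preserves_modspan (gva_mode F u n w).
Proof.
move=> ru sw pu pw; have sub := modspan_subspace.
have [_ uw0 [n0 [n0D n0k]]] := gva_series Fgva ru sw.
have p0 : preserves_modspan 0 by case: preserves_modspan_subspace.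
have uw_nat (i : nat) n' : n' = n0 + i%:R -> preserves_modspan (gva_mode F u n' w).
  by move=> ->; rewrite n0k.
have [nD|/uw0 -> //] := pselect (classZ n = free_Delta g r s).
have [k nk] : exists k : int, n = n0 + k%:~R by apply: classZ_eq; rewrite nD n0D.
case: k nk => [i|j nk]; first exact: uw_nat.
have {nk nD} : n + j.+1%:R = n0 by rewrite nk NegzE rmorphN /= subrK.
elim/ltn_ind: {j}(j.+1) n => j IHj n nj.
have [nD|/uw0 -> //] := pselect (classZ n = free_Delta g r s).
apply: preserves_modspanP => n' t.
(* This exponent lies in the support of the delta function. *)
pose p : R[i] := - (m * r%:~R) - g * r%:~R * (size t)%:~R.
have := gmod_borcherds Mmod ru sw (modvec_deg t) nD p (n' - p).
rewrite /delta_sum eqxx (@fsum_ord _ _ j.+1) => [|i ltji]; last first.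
  rewrite (_ : n + i%:R = n0 + (i - j)%:R); last first.
    by rewrite -nj natrB ?(ltnW ltji) //; ring.
  by rewrite n0k (is_linear0 (gmod_mode_linl Mmod _ _)) scaler0.
rewrite big_ord_recl [n + _]addr0 (_ : p + (n' - p) - _ = n'); last first.
  by rewrite /=; ring.
rewrite {1}/cbinom big_ord0 fact0 divr1 scale1r => /esym/(canRL (addrK _)) ->.
have uwX n1 n2 : modspan (gmod_mode M u n1 (gmod_mode M w n2 (modvec t))).
  exact/pu/pw/modspan_vec.
have wuX n1 n2 : modspan (gmod_mode M w n1 (gmod_mode M u n2 (modvec t))).
  exact/pw/pu/modspan_vec.
apply: (subspaceB sub).
  apply: (subspaceB sub); last apply: (subspaceZ sub).
    by apply: (subspace_fsum _ sub) => i; apply: (subspaceZ sub).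
  by apply: (subspace_fsum _ sub) => i; apply: (subspaceZ sub).
apply: (subspace_sum sub) => i _; apply: (subspaceZ sub).
apply: (IHj (j - i.+1)%N _ (n + i.+1%:R)); last exact: modspan_vec.
  by have := ltn_ord i; lia.
by rewrite -nj natrB ?ltn_ord // -addrA subrKC.
Qed.

(** The Borcherds identity concerns homogeneous vectors, so it is the span of the
    homogeneous good vectors that is shown to be a sub-GVA. *)
Lemma preserves_modspan_all u : preserves_modspan u.
Proof.
pose good u := (exists r, gva_deg F r u) /\ preserves_modspan u.
pose S : set F := fun x => forall P : set F, subspace P ->
  (forall w, good w -> P w) -> P x.
have goodS w : good w -> S w by move=> gw P _ gP; apply: gP.
have goodM w w' n : good w -> good w' -> good (gva_mode F w n w').
  move=> [[r rw] pw] [[s sw'] pw']; split; last first.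
    exact (preserves_modspan_mode n rw sw' pw pw').
  by exists (r + s); have [deg _ _] := gva_series Fgva rw sw'; apply: deg.
have Ssub : subspace S.
  split=> [P [P0 _] _ //|a x y Sx Sy P Psub gP].
  by apply: Psub.2; [apply: Sx | apply: Sy].
have SM w n w' : S w -> S w' -> S (gva_mode F w n w').
  move=> Sw Sw'; apply: (Sw (fun x => S (gva_mode F x n w'))) => [|{w Sw} w gw].
    split=> [|a x y Sx Sy].
      by rewrite (is_linear0 (gva_mode_linl Fgva _ _)); apply: (subspace0 Ssub).
    by rewrite (gva_mode_linl Fgva); apply: Ssub.2.
  apply: (Sw' (fun x => S (gva_mode F w n x))) => [|w'' gw''].
    split=> [|a x y Sx Sy].
      by rewrite (is_linear0 (gva_mode_linr Fgva _ _)); apply: (subspace0 Ssub).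
    by rewrite (gva_mode_linr Fgva); apply: Ssub.2.
  by apply: goodS; apply: goodM.
have gvac : good (gva_vac F).
  by split; [exists 0; apply: gva_vac_deg Fgva | apply: preserves_modspan_vac].
have Ssubgva : subgva S.
  split=> // [|w Sw]; first exact: goodS.
  have -> : gva_der F w = gva_mode F w (- 2) (gva_vac F).
    have := gva_der_mode Fgva w (-1) (gva_vac F).
    rewrite (gva_creation Fgva w).1 (gva_der_vac Fgva).
    rewrite (is_linear0 (gva_mode_linr Fgva _ _)) subr0 opprK scale1r => ->.
    by rewrite -opprD.
  by apply: SM => //; apply: goodS.
have gb : good b.
  by split; [exists 1; apply: in_G_deg hF | apply: preserves_modspan_gen].
have Su : S u.
  have : gen_subgva b u by rewrite (in_G_gen hF).
  by apply=> //; apply: goodS.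
by apply: Su => [|w []] //; apply: preserves_modspan_subspace.
Qed.

Lemma modspan_full x : modspan x.
Proof.
have : gen_submod v x by rewrite (in_Mod_gen hM).
apply; last exact: (modspan_vec [::]).
split=> [|u n y]; first exact: modspan_subspace.
exact: preserves_modspan_all.
Qed.

End FreeModule.

(** * The map to the lattice module *)

Section LatticeModule.
Variables (R : realType) (h : vectType R[i]) (form : h -> h -> R[i]).
Variables (beta : h) (m : R[i]).
Hypothesis hform : is_form form.
Hypothesis hbeta : form beta beta != 0.
Local Notation g := (form beta beta).

Definition weight (l : int) : h := m *: beta_dual form beta + beta *~ l.

Lemma weightS (r : nat) : weight r.+1 = beta + weight r.
Proof. by rewrite /weight intS mulrzDr mulr1z addrCA. Qed.

Lemma form_weight l : form beta (weight l) = m + g * l%:~R.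
Proof.
rewrite (form_sym hform) /weight (form_linl hform) -scaler_int.
have form0 z : form 0 z = 0.
  have := form_linl hform (-1) 0 0 z.
  by rewrite scaler0 addr0 mulN1r addNr.
have formZ a z : form (a *: beta) z = a * form beta z.
  by have := form_linl hform a beta 0 z; rewrite addr0 form0 addr0.
by rewrite /beta_dual !formZ mulVf // mulr1 mulrC.
Qed.

Lemma weight_inj : injective weight.
Proof.
move=> k l /(congr1 (form beta)); rewrite !form_weight => /addrI /(mulfI hbeta).
exact: intr_inj.
Qed.

Lemma fock_exp_free :
  free_family (fun r : nat => fock_exp (weight r) : fock h).
Proof.
move=> w w0; apply/malgP => r.
rewrite -(@mcoeff_reindex _ _ _ (fun r : nat => (weight r, mset0) : fock_index h)).
  by rewrite [malg_ext _ _]w0 !mcoeff0.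
by move=> s _ [/weight_inj [->]].
Qed.

Lemma lattice_mode_exp n x :
  lattice_mode form beta (fock_exp beta) n x = vertex_exp form beta beta n x.
Proof. by rewrite /lattice_mode fock_ext_basis /= enum_mset0. Qed.

Variables (F : gva R int) (b : F).
Variables (phi : F -> W_L form beta) (hphi : gva_hom phi).
Hypothesis hphib : phi b = W_L_gen form beta.
Variables (M : gmod F int) (v : M).
Variable chi : M -> pull_gmod phi (W_L_mod form beta m).
Hypotheses (hchi : gmod_hom chi) (hchiv : chi v = W_L_mod_gen form beta m).

Definition chi_val (x : M) : fock h := subspace_val (chi x).

Lemma chi_val_linear : is_linear chi_val.
Proof. by move=> a x y; rewrite /chi_val (gmod_hom_lin hchi). Qed.

Lemma chi_val_gen n x :
  chi_val (gmod_mode M b n x) = vertex_exp form beta beta n (chi_val x).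
Proof.
rewrite /chi_val (gmod_hom_mode hchi) /= hphib; exact: lattice_mode_exp.
Qed.

(** Both sides satisfy the recursion of [sym_vec], by [hvec_cons_vertex]. *)
Lemma chi_val_modvec s :
  chi_val (modvec g m b v s) =
  hvec (hsym (cre form beta)) (fock_exp (weight (size s))) s.
Proof.
move: {2}(size s) (erefl (size s)) => r; elim: r s => [|r IHr] [|n s] //.
  by rewrite /chi_val hchiv /= /weight mulr0z addr0.
move=> [szs]; rewrite [size _]/= weightS.
rewrite (hvec_cons_vertex hbeta) /modvec sym_vec_cons.
rewrite (linear_shift_sum _ _ _ chi_val_linear).
apply: eq_shift_sum => t u szu _; rewrite chi_val_gen form_weight.
have := IHr u; rewrite szu => /(_ szs); rewrite -/(modvec g m b v u) => ->.
by [].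
Qed.

(** The image is a sub-GVA that contains the generator. *)
Lemma phi_surj u : exists u', phi u' = u.
Proof.
pose S : set (lattice_gva form beta) := fun x =>
  exists u', subspace_val (phi u') = x.
suff [u' u'E] : S (subspace_val u) by exists u'; apply: val_inj.
apply: (subspace_valP u) => //; last by exists b; rewrite hphib.
split=> [|||_ n _ [x <-] [y <-]].
- split=> [|a _ _ [x <-] [y <-]]; last first.
    by exists (a *: x + y); rewrite (gva_hom_lin hphi).
  by exists 0; rewrite (is_linear0 (gva_hom_lin hphi)).
- by exists (gva_vac F); rewrite (gva_hom_vac hphi).
- by move=> _ [x <-]; exists (gva_der F x); rewrite (gva_hom_der hphi).
- by exists (gva_mode F x n y); rewrite (gva_hom_mode hphi).
Qed.

(** The image is a submodule that contains the generator. *)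
Lemma chi_surj y : exists x, chi x = y.
Proof.
pose S : set (lattice_gmod form beta) := fun x => exists x', chi_val x' = x.
suff [x xE] : S (subspace_val y) by exists x; apply: val_inj.
apply: (subspace_valP y) => //; last by exists v; rewrite /chi_val hchiv.
split=> [|u n _ [x <-]].
  split=> [|a _ _ [x <-] [x' <-]]; last first.
    by exists (a *: x + x'); apply: chi_val_linear.
  by exists 0; apply: is_linear0 chi_val_linear.
have [u' <-] := phi_surj u.
by exists (gmod_mode M u' n x); rewrite /chi_val (gmod_hom_mode hchi).
Qed.

Hypotheses (hF : in_G g b) (hM : in_Mod g m b v).

(** The vectors [modvec S] span M and have linearly independent images. *)
Lemma chi_val_eq0 x : chi_val x = 0 -> x = 0.
Proof.
have [w ->] := modspan_full hF hM x.
rewrite /modcomb /malg_ext (is_linear_sum chi_val_linear) => w0.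
suff -> : w = 0 by rewrite msupp0 big_nil.
have heisP := fock_heis_pair hbeta.
apply: (hcomb_inj (hsym_linear heisP) (hsymC heisP) hbeta
  (ann_lin heisP) (hsym0 _) (ann_hsym heisP) _ fock_exp_free).
  by move=> N r; apply: ann_fock_exp.
rewrite -[RHS]w0; apply: eq_bigr => S _.
by rewrite (is_linearZ chi_val_linear) chi_val_modvec.
Qed.

Lemma chi_inj : injective chi.
Proof.
move=> x y eqxy; apply/subr0_eq/chi_val_eq0.
by rewrite (is_linearB chi_val_linear) /chi_val eqxy subrr.
Qed.

(** The components of x outside degree l have an image that is both in degree l
    and outside of it, hence zero. *)
Lemma chi_deg_inv l x : fock_deg (weight l) (chi_val x) -> gmod_deg M l x.
Proof.
move=> degx; have [Msub Mdec _] := gmod_grading (in_Mod_gmod hM).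
have [s [f [degf xE]]] := Mdec x.
have degM k y : gmod_deg M k y -> fock_deg (weight k) (chi_val y).
  by move=> /(gmod_hom_deg hchi).
rewrite xE (bigID (pred1 l)) /= in degx *.
set y := \sum_(i <- s | i == l) f i in degx *.
set z := \sum_(i <- s | i != l) f i in degx *.
have ly : gmod_deg M l y.
  rewrite /y -big_filter; apply: subspace_sum => // i.
  by rewrite mem_filter => /andP[/eqP ->].
suff -> : z = 0 by rewrite addr0.
apply: chi_val_eq0; apply/malgP => t; rewrite mcoeff0.
have [tl|tl] := eqVneq t.1 (weight l).
  rewrite /z (is_linear_sum chi_val_linear) raddf_sum big1 //= => i il.
  apply: ((fock_degP _ _).1 (degM i (f i) (degf i)) t).
  by rewrite tl; apply: contraNneq il => /weight_inj ->.
have /fock_degP/(_ t tl) := degx; rewrite (is_linearD chi_val_linear) mcoeffD.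
by have /fock_degP/(_ t tl) -> := degM _ _ ly; rewrite add0r.
Qed.

End LatticeModule.

Theorem lemma6 (R : realType) (g m : R[i]) (hg : g != 0)
  (h : vectType R[i]) (hdim : \dim {:h} = 1%N)
  (form : h -> h -> R[i]) (hform : is_form form)
  (beta : h) (hbeta : form beta beta = g)
  (F : gva R int) (b : F) (hF : is_free_gva g b)
  (phi : F -> W_L form beta) (hphi : gva_hom phi)
  (hphib : phi b = W_L_gen form beta)
  (M : gmod F int) (v : M) (hM : is_free_mod g m b v)
  (chi : M -> pull_gmod phi (W_L_mod form beta m)) (hchi : gmod_hom chi)
  (hchiv : chi v = W_L_mod_gen form beta m) :
  gmod_iso chi.
Proof.
move: hg hF.1 hM.1; rewrite -hbeta => beta0 Fg Mm; split=> //.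
have chiI := chi_inj hform beta0 hphib hchi hchiv Fg Mm.
have [chi' chi'K] := choice (chi_surj hphi hphib hchi hchiv).
have chiK : cancel chi chi' by move=> x; apply: chiI.
exists chi'; split=> //; split=> [a y z|l y ly|u n y]; last 1 first.
- by apply: chiI; rewrite (gmod_hom_mode hchi) !chi'K.
- by apply: chiI; rewrite (gmod_hom_lin hchi) !chi'K.
- apply: (chi_deg_inv hform beta0 hphib hchi hchiv Fg Mm).
  by rewrite /chi_val chi'K.
Qed.
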